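(* For every real $u$ and every integer $b>1600$, $$V(u,b)\ \ge\ V_W(u,b)\left(1-\frac{5}{12b}\left(1+\frac1{\sqrt b}\right)\right).$$
   Context: Let $X_1,X_2,\dots$ be i.i.d. with $P(X_i=1)=P(X_i=-1)=1/2$ and $S_k=\sum_{i=1}^k X_i$, $S_0=0$. For real $u$ and positive integer $b$, $V(u,b)=\sup_T E\left[\frac{u+S_T}{b+T}\right]$, the supremum over all a.s. finite stopping times $T$ (with values in $\{0,1,2,\dots\}$) of the walk. Let $W(t)$, $t\ge0$, be standard Brownian motion with $W(0)=0$. For real $u$ and $b>0$, $V_W(u,b)=\sup_T E\left[\frac{u+W(T)}{b+T}\right]$, the supremum over stopping times $T\geq 0$ for which the expectation exists. It is known (Shepp, Walker) that, with $\alpha=0.83992\ldots$ the unique real root of $\alpha=(1-\alpha^2)\int_0^\infty \exp(\lambda\alpha-\lambda^2/2)\,d\lambda$, one has $V_W(u,b)=(1-\alpha^2)\int_0^\infty\exp(\lambda u-\lambda^2b/2)\,d\lambda$ for $u\le\alpha\sqrt b$ and $V_W(u,b)=u/b$ for $u>\alpha\sqrt b$. *)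

(* Defs.v *)
From HB Require Import structures.
From mathcomp Require Import all_boot all_order all_algebra.
From mathcomp Require Import all_classical all_reals all_analysis.
Import Order.TTheory GRing.Theory Num.Theory.
Import numFieldNormedType.Exports.

Set Implicit Arguments.
Unset Strict Implicit.
Unset Printing Implicit Defensive.

Local Open Scope classical_set_scope.
Local Open Scope ring_scope.
Local Open Scope ereal_scope.

Definition sigma_of {R : realType} {Omega I : Type} (D : set I)
    (Y : I -> Omega -> R) : set (set Omega) :=
  <<s \bigcup_(i in D) preimage_set_system setT (Y i) measurable >>.

Definition mutually_independent {R : realType} {d : measure_display}
    {Omega : measurableType d} (P : probability Omega R) {I : eqType}
    (X : I -> {RV P >-> R}) : Prop :=
  forall (s : seq I) (B : I -> set R), uniq s ->
    (forall i, measurable (B i)) ->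
    P (\bigcap_(i in [set` s]) (X i @^-1` B i)) =
      \prod_(i <- s) P (X i @^-1` B i).

(* The indices are shifted by one: [X i] is the (i+1)-st step of the walk. *)
Definition fair_coin_steps {R : realType} {d : measure_display}
    {Omega : measurableType d} (P : probability Omega R)
    (X : nat -> {RV P >-> R}) : Prop :=
  mutually_independent X /\
  forall i, P (X i @^-1` [set 1%R]) = (2^-1)%:E /\
            P (X i @^-1` [set (-1)%R]) = (2^-1)%:E.

Definition walk {R : realType} {d : measure_display}
    {Omega : measurableType d} (P : probability Omega R)
    (X : nat -> {RV P >-> R}) (n : nat) (w : Omega) : R :=
  (\sum_(i < n) X i w)%R.

(* [None] stands for the value +oo, which may be taken on a null set. *)
Definition walk_stopping_time {R : realType} {d : measure_display}
    {Omega : measurableType d} (P : probability Omega R)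
    (X : nat -> {RV P >-> R}) (T : Omega -> option nat) : Prop :=
  (forall n, sigma_of [set k | (k <= n)%N] (walk X)
               [set w | T w = Some n]) /\
  {ae P, forall w, T w <> None}.

Definition walk_payoff {R : realType} {d : measure_display}
    {Omega : measurableType d} (P : probability Omega R)
    (X : nat -> {RV P >-> R}) (u : R) (b : nat) (T : Omega -> option nat)
    (w : Omega) : R :=
  if T w is Some n then ((u + walk X n w) / (b + n)%:R)%R else 0%R.

(* All these payoffs are bounded by |u| / b + 1 when b > 0, so that their
   expectations are always defined. *)
Definition V {R : realType} {d : measure_display}
    {Omega : measurableType d} (P : probability Omega R)
    (X : nat -> {RV P >-> R}) (u : R) (b : nat) : \bar R :=
  ereal_sup [set 'E_P[walk_payoff X u b T] | T in walk_stopping_time X].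

(* Only the times t >= 0 matter; [normal_prob m s] is the Gaussian law of mean
   m and standard deviation (not variance) s. *)
Definition brownian_motion {R : realType} {d : measure_display}
    {Omega : measurableType d} (P : probability Omega R)
    (W : R -> {RV P >-> R}) : Prop :=
  [/\ {ae P, forall w, W 0%R w = 0%R},
      {ae P, forall w, {within `[0%R, +oo[, continuous (fun t => W t w)}},
      forall s t : R, (0 <= s)%R -> (s < t)%R ->
        forall B : set R, measurable B ->
        P [set w | B (W t w - W s w)%R] =
          normal_prob 0 (Num.sqrt (t - s)) B
    & forall s t : R, (0 <= s)%R -> (s < t)%R ->
        forall (A : set Omega) (B : set R),
        sigma_of `[0%R, s] W A -> measurable B ->
        P (A `&` [set w | B (W t w - W s w)%R]) =
          P A * P [set w | B (W t w - W s w)%R] ].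

Definition brownian_stopping_time {R : realType} {d : measure_display}
    {Omega : measurableType d} (P : probability Omega R)
    (W : R -> {RV P >-> R}) (T : Omega -> \bar R) : Prop :=
  [/\ forall w, 0 <= T w,
      forall t : R, (0 <= t)%R ->
        sigma_of `[0%R, t] W [set w | T w <= t%:E]
    & {ae P, forall w, T w < +oo}].

Definition brownian_payoff {R : realType} {d : measure_display}
    {Omega : measurableType d} (P : probability Omega R)
    (W : R -> {RV P >-> R}) (u b : R) (T : Omega -> \bar R)
    (w : Omega) : R :=
  ((u + W (fine (T w)) w) / (b + fine (T w)))%R.

Definition V_W {R : realType} {d : measure_display}
    {Omega : measurableType d} (P : probability Omega R)
    (W : R -> {RV P >-> R}) (u b : R) : \bar R :=
  ereal_sup [set 'E_P[brownian_payoff W u b T] |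
    T in [set T | brownian_stopping_time W T /\
                  P.-integrable setT (EFin \o brownian_payoff W u b T)]].

(* Main.v *)
Require Import Defs.
From HB Require Import structures.
From mathcomp Require Import all_boot all_order all_algebra.
From mathcomp Require Import all_classical all_reals all_analysis measurable_realfun.
From mathcomp Require Import ring lra.
Import Order.TTheory GRing.Theory Num.Theory.
Import numFieldNormedType.Exports.
Set Implicit Arguments.
Unset Strict Implicit.
Unset Printing Implicit Defensive.
Local Open Scope classical_set_scope.
Local Open Scope ring_scope.

(** Upper bound for Brownian motion: the tangent at the root alpha gives
    [x / t <= (1 - alpha^2) \int_0^oo exp (l x - l^2 t / 2) dl] for all [x] and
    all [t > 0], and the right-hand side, evaluated along [(u + W, b + T)], is a
    mixture of exponential martingales, so its expectation never exceeds its
    initial value. When [u > alpha sqrt b] the excess [c = u - alpha sqrt b]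
    contributes at most [c / b].

    Lower bound for the walk: [J u b = \int_0^(1/2) exp (l u) / (cosh l)^(b+1) dl]
    is a martingale along [(u + S_n, b + n)]. The walk is stopped as soon as
    [u + S_n >= alpha sqrt (b + n) - 1/2]; since steps have size 1, it then lies
    within 1/2 of the curve [alpha sqrt (b + n)]. Comparing [J] with Gaussian
    moments at the start and at the stopping point costs relative errors of
    order [1/b] whose leading coefficients [(4 - alpha^2) / 12] and
    [alpha^2 / 6 - 1/18] add up to at most [13/36 < 5/12]. Optional stopping is
    only used with a finite horizon [N], with an error tending to 0. *)

(** * Taylor polynomials of the exponential function *)

Section exponential_bounds.
Context {R : realType}.
Implicit Types (x y : R) (n : nat).

(** At the root [a] both [(1 - a^2) * mom 0 a 1 = a] and [(1 - a^2) * mom 1 a 1 = 1] hold: the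
    Gaussian integral meets the payoff with equal value and equal slope. Hence an overshoot [s] at
    the stopping point costs only a term of relative order [s^2 / b], and lowering the threshold by
    1/2 centres the overshoot, so that [s^2 <= 1/4]. The moment recurrence turns every
    [(1 - a^2) * mom k a 1] into a polynomial in [a]; the stopping loss is therefore computed from
    [3/4 <= a < 1] alone.

    An exponent [b + c] of cosh gives a martingale for every constant [c]. A larger [c] lowers [J],
    which raises the loss at the start and reduces the loss at the stop; [c = 1] leads to the sum
    13/36. The gap [5/12 - 13/36 = 1/18] is the room for all higher-order terms, and
    [b > 1600 = 40^2], that is [1 / sqrt b <= 1/40], makes them fit.

    The strategy is evaluated by a backward recursion on real numbers; probability enters only when
    this recursion is matched with a stopping time. *)

Lemma le_of_derive_ge0 (f df : R -> R) x : 0 <= x ->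
  (forall y, is_derive y 1 f (df y)) -> (forall y, 0 <= y <= x -> 0 <= df y) ->
  f 0 <= f x.
Proof.
move=> x0 dfE df0.
have cf : {within `[0, x], continuous f}.
  apply: derivable_within_continuous => y _.
  exact: (@ex_derive _ _ _ _ _ _ _ (dfE y)).
have [c] := MVT_segment x0 (fun y _ => dfE y) cf.
rewrite in_itv/= => c0x fE; rewrite -subr_ge0 fE mulr_ge0 ?df0//.
by rewrite subr0.
Qed.

Definition exp_taylor n x : R := \sum_(k < n) x ^+ k / k`!%:R.

Lemma exp_taylor0 x : exp_taylor 0 x = 0.
Proof. by rewrite /exp_taylor big_ord0. Qed.

Lemma exp_taylorS0 n : exp_taylor n.+1 0 = 1.
Proof.
rewrite /exp_taylor big_ord_recl expr0 fact0 divr1 big1 ?addr0// => i _.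
by rewrite expr0n mul0r.
Qed.

Lemma is_derive_exp_taylor n x :
  is_derive x 1 (exp_taylor n.+1) (exp_taylor n x).
Proof.
have -> : exp_taylor n.+1 = \sum_(k < n.+1) (fun y => y ^+ k / k`!%:R).
  by apply/funext => y; rewrite fct_sumE.
rewrite /exp_taylor.
have H (k : 'I_n.+1) :
    is_derive x 1 (fun y : R => y ^+ k / k`!%:R) (k%:R * x ^+ k.-1 / k`!%:R).
  have -> : (fun y : R => y ^+ k / k`!%:R) = (k`!%:R^-1 \*: (id ^+ k : R -> R)).
    by apply/funext => y /=; rewrite !fctE mulrC.
  apply: is_derive_eq; rewrite /GRing.scale/= mulr1 -mulr_natl; ring.
apply: (is_derive_eq (is_derive_sum H)).
rewrite big_ord_recl mul0r mul0r add0r; apply: eq_bigr => i _.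
rewrite /= /bump /= add1n factS natrM invfM mulrACA.
have ? : (i.+1%:R : R) != 0 by rewrite pnatr_eq0.
have ? : (i`!%:R : R) != 0 by rewrite pnatr_eq0 -lt0n fact_gt0.
by field; apply/andP.
Qed.

Lemma exp_taylor_le n x : 0 <= x -> exp_taylor n x <= expR x.
Proof.
elim: n x => [|n IHn] x x0; first by rewrite exp_taylor0 expR_ge0.
rewrite -subr_ge0.
have := @le_of_derive_ge0 (expR - exp_taylor n.+1) (expR - exp_taylor n) x x0.
rewrite !fctE exp_taylorS0 expR0 subrr; apply => y.
  by apply: is_deriveB; exact: is_derive_exp_taylor.
by move=> /andP[y0 _]; rewrite subr_ge0 IHn.
Qed.

(** Lagrange remainder with the intermediate exponential bounded by [expR x]. The induction runs
    over all [y] in [[0, x]] with this constant fixed, so that differentiating in [y] lowers the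
    order by one. *)
Lemma exp_le_taylor n x : 0 <= x ->
  expR x <= exp_taylor n x + expR x * x ^+ n / n`!%:R.
Proof.
move=> x0.
suff H m y : 0 <= y <= x ->
    expR y <= exp_taylor m y + expR x * y ^+ m / m`!%:R.
  by apply: H; rewrite x0 lexx.
elim: m y => [|m IHm] y /andP[y0 yx].
  by rewrite exp_taylor0 expr0 mulr1 fact0 divr1 add0r ler_expR.
pose c := expR x / m.+1`!%:R.
pose F z := exp_taylor m.+1 z + c * z ^+ m.+1 - expR z.
have dF (z : R) : is_derive z 1 F
    (exp_taylor m z + expR x * z ^+ m / m`!%:R - expR z).
  rewrite (_ : F = exp_taylor m.+1 + c \*: (id ^+ m.+1 : R -> R) - expR); last first.
    by apply/funext => t; rewrite /F /= !fctE.
  apply: is_deriveB; apply: is_deriveD; first exact: is_derive_exp_taylor.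
  apply: is_derive_eq; rewrite /GRing.scale/= mulr1 -mulr_natl /c factS natrM.
  have ? : (m.+1%:R : R) != 0 by rewrite pnatr_eq0.
  have ? : (m`!%:R : R) != 0 by rewrite pnatr_eq0 -lt0n fact_gt0.
  by field; apply/andP; rewrite ?nat1r.
have := le_of_derive_ge0 y0 dF.
rewrite /F exp_taylorS0 expR0 expr0n/= mulr0 addr0 subrr subr_ge0.
rewrite /c mulrAC; apply => z /andP[z0 zy].
by rewrite subr_ge0 IHm// z0 (le_trans zy).
Qed.

(** Partial sums of [exp (-x)] lie alternately below and above it: differentiating in [x] lowers the
    order and flips the sign. *)
Lemma expN_taylor n x : 0 <= x ->
  0 <= (-1) ^+ n * (expR (- x) - exp_taylor n (- x)).
Proof.
elim: n x => [|n IHn] x x0.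
  by rewrite exp_taylor0 expr0 mul1r subr0 expR_ge0.
have dN (f : R -> R) (df z : R) : is_derive (- z) 1 f df ->
    is_derive z 1 (f \o -%R) (- df).
  by move=> ?; apply: is_derive_eq; rewrite mulrN1.
pose F z := (-1) ^+ n.+1 * (expR (- z) - exp_taylor n.+1 (- z)).
have dF (z : R) : is_derive z 1 F ((-1) ^+ n * (expR (- z) - exp_taylor n (- z))).
  rewrite (_ : F = (-1) ^+ n.+1 \*: ((expR - exp_taylor n.+1) \o -%R))//.
  have ? : is_derive z 1 ((expR - exp_taylor n.+1) \o -%R)
      (- (expR (- z) - exp_taylor n (- z))).
    by apply: dN; apply: is_deriveB; exact: is_derive_exp_taylor.
  by apply: is_derive_eq; rewrite /GRing.scale/= exprS; ring.
have := le_of_derive_ge0 x0 dF.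
rewrite /F oppr0 exp_taylorS0 expR0 subrr mulr0.
by apply => y /andP[y0 _]; apply: IHn.
Qed.

End exponential_bounds.

(** * Explicit inequalities for exp and cosh *)

Section exponential_estimates.
Context {R : realType}.
Implicit Types x y z : R.

Lemma expR_ge_quadratic y : 0 <= y -> 1 + y + y ^+ 2 / 2 <= expR y.
Proof.
move=> /(exp_taylor_le 3); rewrite /exp_taylor !big_ord_recr !big_ord0/=.
by rewrite !factS fact0 !muln1; apply: le_trans; rewrite le_eqVlt; apply/orP; left; apply/eqP; field.
Qed.

(** [exp (-1/4) >= 3/4], inverted. *)
Lemma expR_quarter_le x : x <= 1 / 4 -> expR x <= 4 / 3.
Proof.
move=> x4; apply: (@le_trans _ _ (expR (1 / 4))); first by rewrite ler_expR.
have := expR_ge1Dx (- (1 / 4) : R); rewrite expRN => h.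
have := @expR_gt0 R (1 / 4); have := @expRxMexpNx_1 R (1 / 4).
by move: h; rewrite expRN; set e := expR _; set f := e^-1; nra.
Qed.

(** [2/9 = (4/3) / 6]: the third-order remainder with [exp y <= 4/3]. *)
Lemma expR_le_cubic y : 0 <= y <= 1 / 4 ->
  expR y <= 1 + y + y ^+ 2 / 2 + 2 / 9 * y ^+ 3.
Proof.
move=> /andP[y0 y4]; have := exp_le_taylor 3 y0.
have := expR_quarter_le y4; have := exprn_ge0 3 y0.
rewrite /exp_taylor !big_ord_recr !big_ord0/= !factS fact0 !muln1 ?natrM.
rewrite !expr0 !expr1.
set e := expR y; set y3 := y ^+ 3; set y2 := y ^+ 2 => h3 he; nra.
Qed.

Lemma expRN_le_quadratic y : y <= 0 -> expR y <= 1 + y + y ^+ 2 / 2.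
Proof.
move=> y0; have := @expN_taylor _ 3 (- y); rewrite oppr_ge0 opprK => /(_ y0).
rewrite /exp_taylor !big_ord_recr !big_ord0/= !factS fact0 !muln1 ?natrM.
rewrite !expr0 !expr1 (_ : (-1) ^+ 3 = -1 :> R); last by ring.
set e := expR y; set y2 := y ^+ 2; nra.
Qed.

(** [5/9 = 1/2 + 2/9 * 1/4]. This constant later measures the cost of the overshoot. *)
Lemma expR_le_quadratic x : x <= 1 / 4 -> expR x <= 1 + x + 5 / 9 * x ^+ 2.
Proof.
move=> x4; have [x0|/ltW x0] := leP 0 x.
  have := @expR_le_cubic x; rewrite x0 x4 => /(_ isT) /le_trans; apply.
  by rewrite exprS; have := sqr_ge0 x; set y := x ^+ 2; nra.
by apply: (le_trans (expRN_le_quadratic x0)); have := sqr_ge0 x; lra.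
Qed.

Lemma expR_le_quadratic_expR z y : 0 <= y -> z <= y ->
  expR z <= 1 + z + z ^+ 2 / 2 * expR y.
Proof.
move=> y0 zy; have [z0|/ltW z0] := leP 0 z.
  have := exp_le_taylor 2 z0; rewrite /exp_taylor !big_ord_recr !big_ord0/=.
  rewrite !factS fact0 !muln1 expr0 expr1.
  have : expR z <= expR y by rewrite ler_expR.
  have := sqr_ge0 z; set z2 := z ^+ 2; set e := expR z; set f := expR y; nra.
apply: (le_trans (expRN_le_quadratic z0)); rewrite lerD2l.
rewrite ler_peMr ?divr_ge0 ?sqr_ge0//.
by rewrite -[leLHS]expR0 ler_expR.
Qed.

Definition ch x : R := (expR x + expR (- x)) / 2.

Lemma ch_gt0 x : 0 < ch x.
Proof. by rewrite divr_gt0 ?addr_gt0 ?expR_gt0. Qed.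

Lemma ch_ge_quartic x : 0 <= x -> 1 + x ^+ 2 / 2 + x ^+ 4 / 24 <= ch x.
Proof.
move=> x0; have := exp_taylor_le 6 x0; have := @expN_taylor _ 6 x x0.
rewrite /ch /exp_taylor !big_ord_recr !big_ord0/= !factS fact0 !muln1 ?natrM.
rewrite (_ : (-1) ^+ 6 = 1 :> R); last by ring.
set e := expR x; set f := expR (- x); lra.
Qed.

(** [exp x <= (4/3)^2 = 16/9] on this range; the sixth-order remainders of the two exponentials give
    [(16/9 + 1) / 1440 <= 1/480]. *)
Lemma ch_le_sextic x : 0 <= x <= 1 / 2 ->
  ch x <= 1 + x ^+ 2 / 2 + x ^+ 4 / 24 + x ^+ 6 / 480.
Proof.
move=> /andP[x0 x2]; have := exp_le_taylor 6 x0; have := @expN_taylor _ 7 x x0.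
rewrite /ch /exp_taylor !big_ord_recr !big_ord0/= !factS fact0 !muln1 ?natrM.
rewrite (_ : (-1) ^+ 7 = -1 :> R); last by ring.
have : expR x <= 16 / 9.
  rewrite (_ : x = x / 2 + x / 2); last by field.
  have : expR (x / 2) <= 4 / 3 by apply: expR_quarter_le; lra.
  by rewrite expRD; have := expR_ge0 (x / 2); set e := expR _; nra.
have := exprn_ge0 6 x0; rewrite (_ : (- x) ^+ 6 = x ^+ 6); last by ring.
set x6 := x ^+ 6; set e := expR x; set f := expR (- x); nra.
Qed.

(** [log cosh x = x^2 / 2 - x^4 / 12 + x^6 / 45 - ...]. The coefficient 3/8 is far above 1/45 on
    purpose: being larger than 1/3, it makes [t^4 / 12 - 3/8 t^6] negative for [t >= 1/2], as the
    lower bound on the truncated integral requires. *)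
Lemma ch_le_expR x : 0 <= x <= 1 / 2 ->
  ch x <= expR (x ^+ 2 / 2 - x ^+ 4 / 12 + 3 / 8 * x ^+ 6).
Proof.
move=> xI; apply: (le_trans (ch_le_sextic xI)); case/andP: xI => x0 x2.
rewrite (exprM x 2 2) (exprM x 2 3).
have t0 : 0 <= x ^+ 2 by exact: sqr_ge0.
have : x ^+ 2 <= 1 / 4 by nra.
move: (x ^+ 2) t0 => t t0 t4.
have h1 : 0 <= t / 2 - t ^+ 2 / 12 by nra.
have t3 : 0 <= t ^+ 3 by exact: exprn_ge0.
suff : t ^+ 2 / 4 - t ^+ 3 / 12 <= (t / 2 - t ^+ 2 / 12 + 3 / 8 * t ^+ 3) ^+ 2.
  move=> h; apply: le_trans (expR_ge_quadratic _); last by lra.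
  by move: h; set w := (_ + 3 / 8 * _) ^+ 2; lra.
apply: (@le_trans _ _ ((t / 2 - t ^+ 2 / 12) ^+ 2)).
  by rewrite -subr_ge0 (_ : _ - _ = (t ^+ 2 / 12) ^+ 2) ?sqr_ge0//; field.
by rewrite lerXn2r ?nnegrE//; nra.
Qed.

Lemma expR_le_ch x : 0 <= x <= 1 / 2 ->
  expR (x ^+ 2 / 2 - x ^+ 4 / 12) <= ch x.
Proof.
move=> /andP[x0 x2]; apply: le_trans (ch_ge_quartic x0).
rewrite (exprM x 2 2).
have t0 : 0 <= x ^+ 2 by exact: sqr_ge0.
have : x ^+ 2 <= 1 / 4 by nra.
move: (x ^+ 2) t0 => t t0 t4.
have h1 : 0 <= t / 2 - t ^+ 2 / 12 by nra.
apply: (le_trans (expR_le_cubic _)); first by apply/andP; split => //; nra.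
have h3 : (t / 2 - t ^+ 2 / 12) ^+ 3 <= (t / 2) ^+ 3.
  by rewrite lerXn2r ?nnegrE//; nra.
apply: (@le_trans _ _ (1 + (t / 2 - t ^+ 2 / 12) +
    (t / 2 - t ^+ 2 / 12) ^+ 2 / 2 + 2 / 9 * (t / 2) ^+ 3)).
  by rewrite lerD2l ler_pM2l//; lra.
rewrite -subr_ge0 (_ : _ - _ = t ^+ 3 * (1 / 72 - t / 288)); last by field.
by rewrite mulr_ge0 ?exprn_ge0//; lra.
Qed.

End exponential_estimates.

(** * Integration over the half-line *)

Section half_line.
Context {R : realType}.
Local Notation mu := (@lebesgue_measure R).
Local Notation half := (`[0, +oo[%classic : set R).
Implicit Types (f F : R -> R) (t u b : R) (k : nat).

Let cvgr_expRN : (expR (- t) @[t --> +oo] --> (0 : R)).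
Proof. exact: cvgr_expR. Qed.

Let derive_negexp t : is_derive t 1 (fun s => - expR (- s)) (expR (- t)).
Proof.
have ? : is_derive t 1 (expR \o -%R) (- expR (- t)).
  by apply: is_derive_eq; rewrite mulrN1.
rewrite (_ : (fun s => _) = - (expR \o -%R))//.
by apply: is_derive_eq; rewrite opprK.
Qed.

Lemma continuous_expRN : continuous (fun t => expR (- t)).
Proof. by move=> t; apply: continuous_comp; [exact: continuousN|exact: continuous_expR]. Qed.

Lemma integral_expRN : (\int[mu]_(t in half) (expR (- t))%:E = 1)%E.
Proof.
rewrite (@ge0_continuous_FTC2y _ _ (fun s => - expR (- s)) 0 0).
- by rewrite oppr0 expR0 -EFinB sub0r opprK.
- by move=> t _; rewrite expR_ge0.
- exact/continuous_subspaceT/continuous_expRN.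
- by rewrite -oppr0; exact: cvgN.
- by move=> t _; exact: (@ex_derive _ _ _ _ _ _ _ (derive_negexp t)).
- apply: cvg_at_right_filter; apply: cvgN; exact: continuous_expRN.
- by move=> t _; rewrite derive1E; exact: (@derive_val _ _ _ _ _ _ _ (derive_negexp t)).
Qed.

Lemma integrable_expRN : mu.-integrable half (EFin \o (fun t => expR (- t))).
Proof.
apply/integrableP; split.
  apply/measurable_EFinP; apply: measurable_funTS.
  by apply: continuous_measurable_fun; exact: continuous_expRN.
under eq_integral do rewrite /= ger0_norm ?expR_ge0//.
by rewrite integral_expRN ltry.
Qed.

Lemma integrable_half_dominated f C : measurable_fun setT f ->
  (forall t, 0 <= t -> `|f t| <= C * expR (- t)) ->
  mu.-integrable half (EFin \o f).
Proof.
move=> mf fC.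
apply: (@le_integrable _ _ _ mu half _ _ (EFin \o (fun t => C * expR (- t)))) => //.
- by apply/measurable_EFinP; exact: measurable_funTS.
- move=> t; rewrite /= in_itv/= andbT => t0.
  by rewrite lee_fin (le_trans (fC _ t0))// ler_norm.
- rewrite (_ : _ \o _ = (fun t => C%:E * (expR (- t))%:E)%E); last first.
    by apply/funext => t; rewrite /= EFinM.
  exact/integrableZl/integrable_expRN.
Qed.

(** [f] may change sign, so the fundamental theorem is applied to the nonnegative [f + C exp (-t)],
    and the integral [C] of the added term is subtracted. *)
Lemma Rintegral_half_derive F f C : continuous f ->
  (forall t, is_derive t 1 F (f t)) -> F t @[t --> +oo] --> 0 ->
  (forall t, 0 <= t -> `|f t| <= C * expR (- t)) ->
  \int[mu]_(t in half) f t = - F 0.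
Proof.
move=> cf dF F0 fC.
have mf : measurable_fun setT f by exact: continuous_measurable_fun.
have iF := integrable_half_dominated mf fC.
have iC : mu.-integrable half (EFin \o (fun t => C * expR (- t))).
  rewrite (_ : _ \o _ = (fun t => C%:E * (expR (- t))%:E)%E); last first.
    by apply/funext => t; rewrite /= EFinM.
  exact/integrableZl/integrable_expRN.
have EC : \int[mu]_(t in half) (C * expR (- t)) = C.
  by rewrite RintegralZl//; [rewrite /Rintegral integral_expRN/= mulr1|exact: integrable_expRN].
have dG t : is_derive t 1 (fun s => F s + C * - expR (- s)) (f t + C * expR (- t)).
  rewrite (_ : (fun s => _) = F + C \*: (fun s => - expR (- s)))//.
  exact: (is_deriveD (dF t) (is_deriveZ C (derive_negexp t))).
have cG : continuous (fun s => F s + C * - expR (- s)).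
  move=> t; apply: differentiable_continuous; apply/derivable1_diffP.
  exact: (@ex_derive _ _ _ _ _ _ _ (dG t)).
have : \int[mu]_(t in half) (f t + C * expR (- t)) = 0 - (F 0 + C * - expR (- 0)).
  apply: (@Rintegral_ge0_continuous_FTC2y _ _ (fun s => F s + C * - expR (- s)) 0 0).
  - move=> t t0; have := fC _ t0; rewrite ler_norml => /andP[h _]; lra.
  - apply: continuous_subspaceT => t; apply: cvgD; first exact: cf.
    by apply: cvgM; [exact: cvg_cst|exact: continuous_expRN].
  - rewrite -[X in _ --> X]addr0; apply: cvgD => //.
    rewrite -(mulr0 C); apply: cvgM; first exact: cvg_cst.
    by rewrite -oppr0; exact: cvgN.
  - by move=> t _; exact: (@ex_derive _ _ _ _ _ _ _ (dG t)).
  - by apply: cvg_at_right_filter; exact: cG.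
  - by move=> t _; rewrite derive1E; exact: (@derive_val _ _ _ _ _ _ _ (dG t)).
rewrite RintegralD// EC oppr0 expR0; lra.
Qed.

End half_line.

(** * Gaussian moments on the half-line: recurrence and scaling *)

Section gaussian_moments.
Context {R : realType}.
Local Notation mu := (@lebesgue_measure R).
Local Notation half := (`[0, +oo[%classic : set R).
Implicit Types (t u b r : R) (k : nat).

Definition gauss_mono k u b t : R := t ^+ k * expR (u * t - b * t ^+ 2 / 2).

(** [(1 - a^2) * mom 0 u b] is the Shepp-Walker expression for the value below the curve;
    [mom k u b] is the [k]-th derivative of [mom 0 u b] in [u]. *)
Definition mom k u b : R := \int[mu]_(t in half) gauss_mono k u b t.

Lemma derive_gauss_mono k u b t : is_derive t 1 (gauss_mono k u b)
  (k%:R * gauss_mono k.-1 u b t + u * gauss_mono k u b t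
   - b * gauss_mono k.+1 u b t).
Proof.
have dq : is_derive t 1 (fun t => u * t - b * t ^+ 2 / 2) (u - b * t).
  rewrite (_ : (fun t => _) = u \*: id - (b / 2) \*: (id ^+ 2 : R -> R)).
    by apply: is_derive_eq; rewrite /GRing.scale/= !mulr1 expr1; field.
    apply/funext => s; transitivity (u * s - b / 2 * s ^+ 2); last by [].
    by field.
have de : is_derive t 1 (expR \o (fun t => u * t - b * t ^+ 2 / 2))
    (expR (u * t - b * t ^+ 2 / 2) * (u - b * t)).
  exact: is_derive1_comp.
rewrite (_ : gauss_mono k u b =
  (id ^+ k : R -> R) * (expR \o (fun t => u * t - b * t ^+ 2 / 2))); last first.
  by apply/funext => s; rewrite /= !fctE.
apply: is_derive_eq; rewrite /gauss_mono /= !fctE /GRing.scale/=.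
by rewrite -mulr_natl (exprS t k); ring.
Qed.

Lemma continuous_gauss_mono k u b : continuous (gauss_mono k u b).
Proof.
move=> t; apply: differentiable_continuous; apply/derivable1_diffP.
exact: (@ex_derive _ _ _ _ _ _ _ (derive_gauss_mono k u b t)).
Qed.

Lemma measurable_gauss_mono k u b : measurable_fun setT (gauss_mono k u b).
Proof. apply: continuous_measurable_fun; exact: continuous_gauss_mono. Qed.

Lemma gauss_mono_ge0 k u b t : 0 <= t -> 0 <= gauss_mono k u b t.
Proof. by move=> t0; rewrite mulr_ge0 ?exprn_ge0 ?expR_ge0. Qed.

Lemma exprn_le_expR k t : 0 <= t -> t ^+ k <= k`!%:R * expR t.
Proof.
move=> t0; case: k => [|k].
  by rewrite expr0 fact0 mul1r -[leLHS]expR0 ler_expR.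
rewrite -ler_pdivrMl ?ltr0n ?fact_gt0// mulrC.
by apply: le_trans (expR_ge1Dxn k t0); rewrite lerDr.
Qed.

(** From [t^k <= k! exp t], with a further [exp t] spent to gain the decay [exp (-t)]: the exponent
    [(u + 2) t - b t^2 / 2] is at most [(u + 2)^2 / (2 b)]. *)
Definition gauss_bound k u b : R := k`!%:R * expR ((u + 2) ^+ 2 / (2 * b)).

Lemma gauss_mono_dominated k u b t : 0 < b -> 0 <= t ->
  `|gauss_mono k u b t| <= gauss_bound k u b * expR (- t).
Proof.
move=> b0 t0; rewrite ger0_norm ?gauss_mono_ge0//.
apply: (@le_trans _ _ (k`!%:R * expR t * expR (u * t - b * t ^+ 2 / 2))).
  by rewrite ler_wpM2r ?expR_ge0// exprn_le_expR.
rewrite /gauss_bound -!mulrA ler_wpM2l// -!expRD ler_expR -subr_ge0.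
rewrite (_ : _ - _ = (u + 2 - b * t) ^+ 2 / (2 * b)).
  by rewrite divr_ge0 ?sqr_ge0// mulr_ge0// ltW.
by field; rewrite gt_eqF.
Qed.

Lemma integrable_gauss_mono k u b : 0 < b ->
  mu.-integrable half (EFin \o gauss_mono k u b).
Proof.
move=> b0; apply: (@integrable_half_dominated _ _ (gauss_bound k u b)).
  exact: measurable_gauss_mono.
by move=> t; exact: gauss_mono_dominated.
Qed.

Lemma integral_gauss_mono k u b : 0 < b ->
  (\int[mu]_(t in half) (gauss_mono k u b t)%:E = (mom k u b)%:E)%E.
Proof.
by move=> b0; rewrite /mom /Rintegral fineK//; exact/integrable_fin_num/integrable_gauss_mono.
Qed.

Lemma gauss_mono_cvg0 k u b : 0 < b -> gauss_mono k u b t @[t --> +oo] --> 0.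
Proof.
move=> b0; apply: (@squeeze_cvgr _ _ _ _ (fun=> 0) (fun t => gauss_bound k u b * expR (- t))).
- near=> t; have t0 : 0 <= t by near: t; exact: nbhs_pinfty_ge.
  by rewrite gauss_mono_ge0//= (le_trans _ (gauss_mono_dominated _ _ b0 t0))// ler_norm.
- exact: cvg_cst.
- by rewrite -(mulr0 (gauss_bound k u b)); apply: cvgM; [exact: cvg_cst|exact: cvgr_expR].
Unshelve. all: by end_near. Qed.

(** The integral of the derivative of [gauss_mono k]. The boundary value at 0 survives only for
    [k = 0], where the factor [k%:R] also silences [k.-1]. *)
Lemma mom_rec k u b : 0 < b ->
  k%:R * mom k.-1 u b + u * mom k u b - b * mom k.+1 u b = - (k == 0%N)%:R.
Proof.
move=> b0.
pose f t := k%:R * gauss_mono k.-1 u b t + u * gauss_mono k u b t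
   - b * gauss_mono k.+1 u b t.
have iZ c j : mu.-integrable half (EFin \o (fun t => c * gauss_mono j u b t)).
  rewrite (_ : _ \o _ = (fun t => c%:E * (gauss_mono j u b t)%:E)%E).
    exact/integrableZl/integrable_gauss_mono.
  by apply/funext => t; rewrite /= EFinM.
have iD : mu.-integrable half (EFin \o (fun t => k%:R * gauss_mono k.-1 u b t + u * gauss_mono k u b t)).
  exact: (integrableD _ (iZ _ _) (iZ _ _)).
have <- : \int[mu]_(t in half) f t = k%:R * mom k.-1 u b + u * mom k u b - b * mom k.+1 u b.
  by rewrite RintegralB// RintegralD// !RintegralZl//; exact: integrable_gauss_mono.
pose C := `|k%:R| * gauss_bound k.-1 u b + `|u| * gauss_bound k u b +
  `|b| * gauss_bound k.+1 u b.
apply: (@eq_trans _ _ (- gauss_mono k u b 0)); last first.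
  rewrite /gauss_mono expr0n mulr0 expr0n/= mulr0 mul0r subrr expR0 mulr1.
  by [].
apply: (@Rintegral_half_derive _ _ _ C).
- move=> t; apply: cvgB; [apply: cvgD|]; apply: cvgM; try exact: cvg_cst; exact: continuous_gauss_mono.
- exact: derive_gauss_mono.
- exact: gauss_mono_cvg0.
- move=> t t0.
  have D c j : `|c * gauss_mono j u b t| <= `|c| * gauss_bound j u b * expR (- t).
    by rewrite normrM -mulrA ler_wpM2l//; exact: gauss_mono_dominated.
  rewrite /C !mulrDl (le_trans (ler_normB _ _))// lerD//.
  by rewrite (le_trans (ler_normD _ _))// lerD.
Qed.

Lemma mom_ge0 k u b : 0 <= mom k u b.
Proof.
apply: Rintegral_ge0 => t; rewrite /= in_itv/= andbT; exact: gauss_mono_ge0.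
Qed.

(** Brownian scaling, by the substitution [t := r t]: with [r = 1 / sqrt b] all moments reduce to
    [b = 1] and drift [u r]. *)
Lemma mom_scale k u b r : 0 < r -> r ^+ 2 * b = 1 ->
  mom k u b = r ^+ k.+1 * mom k (u * r) 1.
Proof.
move=> r0 rb.
have b0 : 0 < b by rewrite -(pmulr_rgt0 _ (exprn_gt0 2 r0)) rb.
apply: EFin_inj; rewrite EFinM -!integral_gauss_mono//.
rewrite -integralZl//; last exact: integrable_gauss_mono.
have dF t : is_derive t 1 ( *%R r) r.
  rewrite (_ : *%R r = r \*: id)//.
  by apply: is_derive_eq; rewrite /GRing.scale/= mulr1.
have F'E : derive1 ( *%R r) = cst r.
  by apply/funext => t; rewrite derive1E; exact: (@derive_val _ _ _ _ _ _ _ (dF t)).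
have := @increasing_ge0_integration_by_substitutiony R ( *%R r) (gauss_mono k u b) 0.
rewrite mulr0 F'E => ->.
- apply: eq_integral => t _; rewrite -EFinM; congr EFin.
  rewrite /= !fctE /gauss_mono mul1r exprMn.
  rewrite (_ : b * (r * t) ^+ 2 / 2 = t ^+ 2 / 2).
    by rewrite (mulrA u) (exprS r k); ring.
  by rewrite exprMn mulrA (mulrC b) rb mul1r.
- by move=> x y _ _ xy; rewrite ltr_pM2l.
- by move=> x _; exact: cvg_cst.
- exact: is_cvg_cst.
- exact: is_cvg_cst.
- split; first by move=> x _; exact: (@ex_derive _ _ _ _ _ _ _ (dF x)).
  by apply: cvg_at_right_filter; apply: cvgM; [exact: cvg_cst|exact: cvg_id].
- by apply/gt0_cvgMry => //; exact: cvg_id.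
- exact/continuous_subspaceT/continuous_gauss_mono.
- move=> x; rewrite in_itv/= andbT => /ltW; exact: gauss_mono_ge0.
Qed.

End gaussian_moments.

(** * Moment inequalities and the constant alpha *)

Section moment_estimates.
Context {R : realType}.
Local Notation mu := (@lebesgue_measure R).
Local Notation half := (`[0, +oo[%classic : set R).
Implicit Types (t u b x y : R) (k n : nat).

Lemma integrable_gauss_mono_sum (c : nat -> R) n u b : 0 < b ->
  mu.-integrable half (EFin \o (fun t => \sum_(k < n) c k * gauss_mono k u b t)).
Proof.
move=> b0; elim: n => [|n IHn].
  rewrite (_ : _ \o _ = cst 0%E); first exact: integrable0.
  by apply/funext => t; rewrite /= big_ord0.
rewrite (_ : _ \o _ = EFin \o (fun t => \sum_(k < n) c k * gauss_mono k u b t +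
    c n * gauss_mono n u b t)); last first.
  by apply/funext => t; rewrite /= big_ord_recr.
exact: (integrableD _ IHn (integrableZl _ (c n) (integrable_gauss_mono n u b0))).
Qed.

Lemma Rintegral_gauss_mono_sum (c : nat -> R) n u b : 0 < b ->
  \int[mu]_(t in half) (\sum_(k < n) c k * gauss_mono k u b t) =
  \sum_(k < n) c k * mom k u b.
Proof.
move=> b0; elim: n => [|n IHn].
  under eq_Rintegral do rewrite big_ord0.
  by rewrite big_ord0 Rintegral_cst// mul0r.
under eq_Rintegral do rewrite big_ord_recr/=.
rewrite RintegralD//; first last.
- exact: (integrableZl _ (c n) (integrable_gauss_mono n u b0)).
- exact: integrable_gauss_mono_sum.
rewrite IHn RintegralZl ?big_ord_recr//; exact: integrable_gauss_mono.
Qed.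

Lemma mom_sum_ge0 (c : nat -> R) n u b : 0 < b ->
  (forall t, 0 <= t -> 0 <= \sum_(k < n) c k * t ^+ k) ->
  0 <= \sum_(k < n) c k * mom k u b.
Proof.
move=> b0 c0; rewrite -Rintegral_gauss_mono_sum//; apply: Rintegral_ge0 => t.
rewrite /= in_itv/= andbT => t0; under eq_bigr do rewrite /gauss_mono mulrA.
by rewrite -mulr_suml mulr_ge0 ?expR_ge0 ?c0.
Qed.

Lemma le_mom k u v b : 0 < b -> u <= v -> mom k u b <= mom k v b.
Proof.
move=> b0 uv; apply: le_Rintegral => //; try exact: integrable_gauss_mono.
move=> t; rewrite /= in_itv/= andbT => t0.
by rewrite ler_wpM2l ?exprn_ge0// ler_expR lerD2r ler_wpM2r.
Qed.

(** Convexity in [u]: [exp ((u - v) t) >= 1 + (u - v) t], integrated. *)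
Lemma mom_tangent u v b : 0 < b ->
  mom 0 v b + (u - v) * mom 1 v b <= mom 0 u b.
Proof.
move=> b0; pose c k := nth 0 [:: 1; u - v] k.
rewrite [leLHS](_ : _ = \sum_(k < 2) c k * mom k v b); last first.
  by rewrite !big_ord_recr big_ord0/= /c/= add0r mul1r.
rewrite -Rintegral_gauss_mono_sum//; apply: le_Rintegral => //.
- exact: integrable_gauss_mono_sum.
- exact: integrable_gauss_mono.
move=> t; rewrite /= in_itv/= andbT => t0.
rewrite !big_ord_recr big_ord0/= /c/= add0r /gauss_mono !expr0 expr1 !mul1r.
rewrite mulrA -[X in X + _]mul1r -mulrDl.
rewrite (_ : u * t - b * t ^+ 2 / 2 = (u - v) * t + (v * t - b * t ^+ 2 / 2)).
  by rewrite [in leRHS]expRD ler_wpM2r ?expR_ge0// expR_ge1Dx.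
by ring.
Qed.

Lemma mom1E x : mom 1 x 1 = x * mom 0 x 1 + 1.
Proof. by have := mom_rec 0 x (@ltr01 R); rewrite eqxx/=; lra. Qed.

Lemma momSSE k x : mom k.+2 x 1 = x * mom k.+1 x 1 + k.+1%:R * mom k x 1.
Proof. by have := mom_rec k.+1 x (@ltr01 R); rewrite /=; lra. Qed.

(** Integrate [(t - 1)^2] and [t (t - 1)^2]: at drift 0 the recurrence gives [mom 1 = 1],
    [mom 2 = mom 0] and [mom 3 = 2]. The exact value is [sqrt (pi / 2)]. *)
Lemma mom0_bounds : 1 <= mom 0 (0:R) 1 <= 3 / 2.
Proof.
have m1 := mom1E 0; have m2 := momSSE 0 0; have m3 := momSSE 1 0.
have /mom_sum_ge0 : forall t, 0 <= t -> 0 <= \sum_(k < 3) nth 0 [:: 1; -2; 1] k * t ^+ k.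
  move=> t t0; rewrite !big_ord_recr big_ord0/= expr0 expr1.
  rewrite (_ : _ + _ = (t - 1) ^+ 2) ?sqr_ge0//; ring.
have /mom_sum_ge0 : forall t, 0 <= t -> 0 <= \sum_(k < 4) nth 0 [:: 0; 1; -2; 1] k * t ^+ k.
  move=> t t0; rewrite !big_ord_recr big_ord0/= expr0 expr1.
  rewrite (_ : _ + _ = t * (t - 1) ^+ 2); last by ring.
  by rewrite mulr_ge0// sqr_ge0.
move=> /(_ 0 1 ltr01) + /(_ 0 1 ltr01).
rewrite !big_ord_recr !big_ord0/= m1 m2 m3 m2 m1; lra.
Qed.

Lemma mom0_ge1D x : 1 + x <= mom 0 x 1.
Proof.
have := @mom_tangent x 0 1 ltr01; rewrite subr0 mom1E mul0r add0r mulr1.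
by have /andP[h _] := mom0_bounds; apply: le_trans; rewrite lerD2r.
Qed.

Lemma mom0_gt0 x : 0 < mom 0 x 1.
Proof.
rewrite lt_neqAle mom_ge0 andbT; apply/negP => /eqP m0.
have := mom1E x; have := momSSE 0 x; have := mom_ge0 2 x (1:R).
have := mom_ge0 1 x (1:R); have := mom0_ge1D x; rewrite -m0; nra.
Qed.

Lemma mom0_lipschitz x y : x <= 1 -> y <= 1 ->
  `|mom 0 x 1 - mom 0 y 1| <= mom 1 1 1 * `|x - y|.
Proof.
have main (u v : R) : u <= 1 -> v <= u ->
    `|mom 0 u 1 - mom 0 v 1| <= mom 1 1 1 * `|u - v|.
  move=> u1 vu; rewrite !ger0_norm ?subr_ge0//; last exact: le_mom.
  have := @mom_tangent v u 1 ltr01; have := @le_mom 1 u 1 1 ltr01 u1; nra.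
move=> x1 y1; case: (leP y x) => [yx|/ltW xy]; first exact: main.
by rewrite distrC (distrC x); exact: main.
Qed.

(** Intermediate value theorem between 3/4, where [mom 0 x 1 >= 1 + x] gives [7/16 * 7/4 >= 3/4],
    and 1, where the right-hand side vanishes. *)
Lemma shepp_constant :
  exists2 a : R, 3 / 4 <= a < 1 & a = (1 - a ^+ 2) * mom 0 a 1.
Proof.
(* The Lipschitz bound holds for arguments at most 1; truncating by [Num.min] makes [g] continuous
   on the whole line. *)
pose g x := (1 - (Num.min x 1) ^+ 2) * mom 0 (Num.min x 1) 1 - Num.min x 1.
have cmin : continuous (fun x : R => Num.min x 1).
  by move=> x; apply: continuous_min; [exact: cvg_id|exact: cvg_cst].
have cm : continuous (fun x : R => mom 0 (Num.min x 1) 1).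
  move=> x; apply/cvgrPdist_le => e e0.
  have L0 : 0 < mom 1 (1:R) 1 by rewrite mom1E mul1r; have := mom_ge0 0 (1:R) 1; lra.
  have d0 : 0 < e / mom 1 (1:R) 1 by rewrite divr_gt0.
  have /cvgrPdist_le/(_ _ d0) := cmin x.
  apply: filterS => y; rewrite ler_pdivlMr// mulrC; apply: le_trans.
  by apply: mom0_lipschitz; rewrite ge_min lexx orbT.
have cg : continuous g.
  move=> x; apply: cvgB; last exact: cmin.
  apply: cvgM; last exact: cm.
  apply: cvgB; first exact: cvg_cst.
  apply: (cvg_comp _ (fun y => y ^+ 2)); first exact: cmin.
  exact: exprn_continuous.
have g34 : 0 <= g (3 / 4).
  rewrite /g min_l; last by lra.
  by have := mom0_ge1D (3 / 4); lra.
have g1 : g 1 <= 0 by rewrite /g minxx; lra.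
have [|||c] := @IVT R g (3 / 4) 1 0.
- lra.
- exact: continuous_subspaceT.
- by rewrite ge_min le_max g34 g1 orbT.
rewrite in_itv/= => /andP[c34 c1]; rewrite /g min_l// => gc.
exists c; last by lra.
rewrite c34 lt_neqAle c1 andbT; apply/eqP => c1E.
by move: gc; rewrite c1E; lra.
Qed.

Variable a : R.
Hypothesis a34 : 3 / 4 <= a < 1.
Hypothesis aE : a = (1 - a ^+ 2) * mom 0 a 1.

Let a_ge : 3 / 4 <= a. Proof. by case/andP: a34. Qed.
Let a_lt1 : a < 1. Proof. by case/andP: a34. Qed.

(** Smooth fit: with [C = 1 - a^2] one has [C * mom 0 a 1 = a] and [C * mom 1 a 1 = 1], so the
    tangent at [a] of the convex function [C * mom 0 x 1] is the diagonal. *)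
Lemma shepp_tangent x : x <= (1 - a ^+ 2) * mom 0 x 1.
Proof.
have := @mom_tangent x a 1 ltr01; rewrite mom1E.
move: (mom 0 x 1) => q; move: aE; set p := mom 0 a 1 => pE.
rewrite -(ler_pM2l (_ : 0 < 1 - a ^+ 2)); last first.
  by have := a_ge; have := a_lt1; nra.
rewrite (_ : _ * (p + _) = (1 - a ^+ 2) * p * (1 + (x - a) * a) +
  (x - a) * (1 - a ^+ 2)); last by ring.
by rewrite -pE; lra.
Qed.

(** The leading loss at the start. The recurrence rewrites the left side as
    [(3 - x^4) p + x (1 - x^2)] with [p = mom 0 x 1]. *)
Lemma mom_start x : x <= a ->
  6 * mom 2 x 1 - mom 4 x 1 <= (4 - a ^+ 2) * mom 0 x 1.
Proof.
move=> xa; have m1 := mom1E x; have m2 := momSSE 0 x; have m3 := momSSE 1 x.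
have m4 := momSSE 2 x; have p0 := mom_ge0 2 x (1:R); have t := shepp_tangent x.
have m0 := mom0_gt0 x; have a2 : a ^+ 2 <= 1 by have := a_ge; have := a_lt1; nra.
rewrite m4 m3 m2 m1.
rewrite m2 m1 in p0.
move: (mom 0 x 1) m0 p0 t => p {m1 m2 m3 m4} m0 p0 t.
suff : (3 - x ^+ 4) * p + x * (1 - x ^+ 2) <= (4 - a ^+ 2) * p.
  by apply: le_trans; rewrite le_eqVlt; apply/orP; left; apply/eqP; ring.
(* For [x <= -1], [mom 2 x 1 >= 0] gives even the bound [2 p]; for [-1 < x <= 0] the summand
   [x (1 - x^2)] is nonpositive; for [0 < x <= a] it is at most [x <= (1 - a^2) p], which is the
   origin of [4 - a^2]. *)
have [x1|x1] := leP x (-1).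
  have h : 0 <= x ^+ 2 - 1 by nra.
  have : 0 <= (x ^+ 2 - 1) * ((x ^+ 2 + 1) * p + x) by rewrite mulr_ge0//; lra.
  nra.
have h : 0 <= 1 - x ^+ 2 by have := a_lt1; nra.
have x4 : 0 <= x ^+ 4 * p by rewrite mulr_ge0 ?(ltW m0)// (exprM x 2 2) sqr_ge0.
have [x0|x0] := leP x 0.
  have : x * (1 - x ^+ 2) <= 0 by rewrite mulr_le0_ge0.
  have : a ^+ 2 * p <= p by rewrite -[leRHS]mul1r ler_wpM2r// ltW.
  nra.
have : x * (1 - x ^+ 2) <= x * 1 by rewrite ler_wpM2l ?(ltW x0)//; have := sqr_ge0 x; lra.
lra.
Qed.

(** A crude bound for a remainder term. For [x <= 0] the terms of the recurrence with factor [x] are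
    dropped; for [0 < x <= 1] it starts from [mom 1 <= 3/2 mom 0], a consequence of
    [mom 0 >= 1 + x]. *)
Lemma mom6_le x : x <= 1 -> mom 6 x 1 <= 100 * mom 0 x 1.
Proof.
move=> x1.
have m1 := mom1E x; have m2 := momSSE 0 x; have m3 := momSSE 1 x.
have m4 := momSSE 2 x; have m5 := momSSE 3 x; have m6 := momSSE 4 x.
have p1 := mom_ge0 1 x (1:R); have p3 := mom_ge0 3 x (1:R).
have p5 := mom_ge0 5 x (1:R); have p0 := mom_ge0 0 x (1:R).
have p2 := mom_ge0 2 x (1:R); have p4 := mom_ge0 4 x (1:R).
have q := mom0_ge1D x.
move: (mom 0 x 1) (mom 1 x 1) (mom 2 x 1) (mom 3 x 1) (mom 4 x 1) (mom 5 x 1)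
  (mom 6 x 1) m1 m2 m3 m4 m5 m6 p0 p1 p2 p3 p4 p5 q
  => n0 n1 n2 n3 n4 n5 n6 m1 m2 m3 m4 m5 m6 p0 p1 p2 p3 p4 p5 q.
have [x0|x0] := leP x 0.
  have h2 : n2 <= n0 by nra.
  have h4 : n4 <= 3 * n2 by nra.
  have h6 : n6 <= 5 * n4 by nra.
  lra.
have h1 : n1 <= 3 / 2 * n0 by nra.
have h2 : n2 <= 5 / 2 * n0 by nra.
have h3 : n3 <= 11 / 2 * n0 by nra.
have h4 : n4 <= 13 * n0 by nra.
have h5 : n5 <= 35 * n0 by nra.
have h6 : n6 <= n5 + 5 * n4 by nra.
lra.
Qed.

End moment_estimates.

(** * The discrete kernel and its comparison with Gaussian moments *)

Section discrete_kernel.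
Context {R : realType}.
Local Notation mu := (@lebesgue_measure R).
Local Notation half := (`[0, +oo[%classic : set R).
Implicit Types (t u b r : R) (n : nat).

(* Truncating at [1 / 2] preserves the martingale property and makes the
   Taylor bounds on [ch] uniform. *)
Definition kern u n t : R := if t <= 1 / 2 then expR (u * t) / ch t ^+ n else 0.

Definition cosh_int u n : R := \int[mu]_(t in half) kern u n t.

Lemma ch_ge1 t : 1 <= ch t.
Proof.
have := expRxMexpNx_1 t; have := expR_gt0 t; have := expR_gt0 (- t).
rewrite /ch; move: (expR t) (expR (- t)) => p q q0 p0 pq.
have := sqr_ge0 (p - q); nra.
Qed.

Lemma kern_ge0 u n t : 0 <= kern u n t.
Proof.
by rewrite /kern; case: ifP => // _; rewrite divr_ge0 ?expR_ge0 ?exprn_ge0// ltW// ch_gt0.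
Qed.

Lemma measurable_kern u n : measurable_fun setT (kern u n).
Proof.
apply: measurable_fun_ifT => //.
  by apply: measurable_fun_ler => //.
apply: measurable_funM.
  by apply: measurableT_comp => //; apply: measurable_funM.
apply: measurable_funTS; apply: continuous_measurable_fun => t.
apply: cvgV; first by rewrite gt_eqF// exprn_gt0// ch_gt0.
apply: (cvg_comp _ (fun y => y ^+ n)); last exact: exprn_continuous.
apply: cvgM; last exact: cvg_cst.
by apply: cvgD; [exact: continuous_expR|exact: continuous_expRN].
Qed.

Lemma integrable_kern u n : mu.-integrable half (EFin \o kern u n).
Proof.
apply: (@integrable_half_dominated _ _ (expR (`|u| / 2 + 1 / 2))).
  exact: measurable_kern.
move=> t t0; rewrite ger0_norm ?kern_ge0// /kern; case: ifP => [t2|_]; last first.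
  by rewrite mulr_ge0// expR_ge0.
apply: (@le_trans _ _ (expR (u * t))).
  rewrite ler_pdivrMr ?exprn_gt0 ?ch_gt0// ler_peMr ?expR_ge0//.
  by rewrite exprn_ege1// ch_ge1.
rewrite -expRD ler_expR.
have : u * t <= `|u| * (1 / 2).
  rewrite (le_trans (ler_norm _))// normrM ler_wpM2l// ger0_norm//.
lra.
Qed.

Lemma cosh_int_ge0 u n : 0 <= cosh_int u n.
Proof. by apply: Rintegral_ge0 => t _; exact: kern_ge0. Qed.

Lemma le_cosh_int u v n : u <= v -> cosh_int u n <= cosh_int v n.
Proof.
move=> uv; apply: le_Rintegral => //; try exact: integrable_kern.
move=> t; rewrite /= in_itv/= andbT => t0; rewrite /kern; case: ifP => // _.
rewrite ler_wpM2r ?invr_ge0 ?exprn_ge0 ?(ltW (ch_gt0 _))//.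
by rewrite ler_expR ler_wpM2r.
Qed.

Lemma cosh_int_average u n :
  cosh_int u n = 2^-1 * (cosh_int (u + 1) n.+1 + cosh_int (u - 1) n.+1).
Proof.
rewrite /cosh_int -RintegralD//; try exact: integrable_kern.
rewrite -RintegralZl//; last first.
  exact: (integrableD _ (integrable_kern _ _) (integrable_kern _ _)).
apply: eq_Rintegral => t _; rewrite /kern; case: ifP => _; last by rewrite addr0 mulr0.
rewrite !mulrDl mulN1r !mul1r !expRD exprS.
have := gt_eqF (ch_gt0 t); have := gt_eqF (exprn_gt0 n (ch_gt0 t)).
rewrite -mulrDl -mulrDr {3}/ch.
rewrite /ch.
move: (expR (u * t)) (expR t) (expR (- t)) => p q s.
set w := (q + s) / 2 => wn w0.
rewrite (_ : q + s = 2 * w); last by rewrite /w; field.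
by field; rewrite w0 wn.
Qed.

(** [ch_le_expR] bounds the kernel from below, and [exp y >= 1 + y] linearizes it around the
    Gaussian of parameter [n]. The surplus factor [ch t] in the power [n + 1] produces the term
    [- mom 2 / 2]. *)
Lemma cosh_int_ge_mom u n : (1600 < n)%N ->
  mom 0 u n%:R - mom 2 u n%:R / 2 + (n%:R + 1) / 12 * mom 4 u n%:R
   - 3 / 8 * (n%:R + 1) * mom 6 u n%:R <= cosh_int u n.+1.
Proof.
move=> n16; have [b bE] : exists b : R, n%:R = b by exists n%:R.
have b16 : 1601 <= b by rewrite -bE (ler_nat _ 1601).
rewrite bE {n16}.
have b0 : 0 < b by lra.
pose c k := nth 0 [:: 1; 0; -2^-1; 0; (b + 1) / 12; 0; - (3 / 8 * (b + 1))] k.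
rewrite [leLHS](_ : _ = \sum_(k < 7) c k * mom k u b); last first.
  by rewrite !big_ord_recr big_ord0/= /c/=; ring.
rewrite -Rintegral_gauss_mono_sum//; apply: le_Rintegral => //.
- exact: integrable_gauss_mono_sum.
- exact: integrable_kern.
move=> t; rewrite /= in_itv/= andbT => t0.
rewrite [leLHS](_ : _ = (1 + (- t ^+ 2 / 2 + (b + 1) * (t ^+ 4 / 12 - 3 / 8 * t ^+ 6))) *
    expR (u * t - b * t ^+ 2 / 2)); last first.
  by rewrite !big_ord_recr big_ord0/= /c/= /gauss_mono; ring.
rewrite /kern; case: ifPn => [t2|]; last first.
  (* Beyond 1/2 the kernel is 0 and the polynomial is nonpositive:
     [t^4 / 12 - 3/8 t^6 <= - t^4 / 96], and [(b + 1) / (96 * 16) >= 1] absorbs the leading 1. *)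
  rewrite -ltNge => t2; rewrite mulr_le0_ge0 ?expR_ge0//.
  have q : 1 / 4 <= t ^+ 2 by nra.
  have t4 : 1 / 16 <= t ^+ 4.
    by rewrite (exprM t 2 2); move: (t ^+ 2) q => w; nra.
  have t6 : 1 / 4 * t ^+ 4 <= t ^+ 6.
    by rewrite (exprD t 2 4) ler_wpM2r ?exprn_ge0.
  have := sqr_ge0 t.
  have : 0 <= (b + 1) * (t ^+ 6 - 1 / 4 * t ^+ 4) by apply: mulr_ge0; lra.
  have : 0 <= (b - 1601) * (t ^+ 4 - 1 / 16) by apply: mulr_ge0; lra.
  lra.
apply: (@le_trans _ _ (expR (- t ^+ 2 / 2 + (b + 1) * (t ^+ 4 / 12 - 3 / 8 * t ^+ 6)) *
    expR (u * t - b * t ^+ 2 / 2))).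
  by rewrite ler_wpM2r ?expR_ge0// expR_ge1Dx.
rewrite ler_pdivlMr ?exprn_gt0 ?ch_gt0//.
have /(ch_le_expR) : 0 <= t <= 1 / 2 by rewrite t0 t2.
move=> /(lerXn2r n.+1); rewrite !nnegrE expR_ge0 (ltW (ch_gt0 _)) => /(_ isT isT).
rewrite -expRM_natl -natr1 bE => h.
apply: (le_trans (ler_wpM2l _ h)); first by rewrite mulr_ge0 ?expR_ge0.
by rewrite -!expRD ler_expR le_eqVlt; apply/orP; left; apply/eqP; field.
Qed.

(** At a stopping point the drift is [a / r + s]. The factor [exp (s t)] is expanded by
    [expR_le_quadratic], whence [K]; the correction [exp z] to the Gaussian is expanded to first
    order. Its quadratic remainder carries a growing factor, paid for by weakening the Gaussian
    parameter from [n] to [7/10 n] and removing the drift. *)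
Lemma kern_le_gauss (a r s B K : R) n t : (1600 < n)%N ->
  B = (n%:R + 1) / 12 -> K = 5 / 9 * s ^+ 2 -> 0 < r -> r ^+ 2 * n%:R = 1 ->
  `|s| <= 1 / 2 -> 0 <= t ->
  kern (a / r + s) n.+1 t <=
    (1 - t ^+ 2 / 2 + B * t ^+ 4) * (1 + s * t + K * t ^+ 2) *
      expR (a / r * t - n%:R * t ^+ 2 / 2) +
    13 / 20 * expR (2 * a ^+ 2) *
      ((t ^+ 4 / 4 + B ^+ 2 * t ^+ 8) * expR (0 * t - 7 / 10 * n%:R * t ^+ 2 / 2)).
Proof.
move=> n16; have [b bE] : exists b : R, n%:R = b by exists n%:R.
have b16 : 1601 <= b by rewrite -bE (ler_nat _ 1601).
rewrite bE {n16} => BE KE r0 rb s2 t0.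
have [sl su] : - (1 / 2) <= s /\ s <= 1 / 2 by apply/andP; rewrite -ler_norml.
set z := - t ^+ 2 / 2 + B * t ^+ 4.
have z1 : 0 <= 1 + z by rewrite /z BE (exprM t 2 2); have := sqr_ge0 (t ^+ 2 - 1); nra.
rewrite (_ : 1 - t ^+ 2 / 2 + _ = 1 + z); last by rewrite /z; ring.
set E := 1 + s * t + K * t ^+ 2.
have E0 : 0 <= E.
  rewrite /E KE (_ : _ + _ = (5 / 9) * (s * t + 9 / 10) ^+ 2 + 11 / 20); last by field.
  by rewrite addr_ge0// mulr_ge0 ?sqr_ge0//; lra.
have W0 : 0 <= t ^+ 4 / 4 + B ^+ 2 * t ^+ 8.
  by apply: addr_ge0; apply: mulr_ge0; rewrite ?invr_ge0 ?sqr_ge0 ?exprn_ge0.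
rewrite /kern; case: ifPn => [t2|_]; last first.
  by apply: addr_ge0; repeat apply: mulr_ge0; rewrite ?expR_ge0 ?invr_ge0.
have st : s * t <= 1 / 4 by nra.
have eE : expR (s * t) <= E.
  by apply: (le_trans (expR_le_quadratic st)); rewrite /E KE exprMn; lra.
have E13 : E <= 13 / 10.
  have hs : s ^+ 2 <= 1 / 4 by nra.
  have ht : t ^+ 2 <= 1 / 4 by nra.
  have hst : s ^+ 2 * t ^+ 2 <= 1 / 4 * (1 / 4) by apply: ler_pM; rewrite ?sqr_ge0.
  by rewrite /E KE; lra.
(* [t^2 <= 1/4] turns the quartic part of [z] into a quadratic bound, which a Gaussian can
   absorb. *)
set y := B * t ^+ 2 / 4.
have y0 : 0 <= y by rewrite /y !mulr_ge0 ?invr_ge0 ?sqr_ge0//; lra.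
have zy : z <= y.
  rewrite /z /y (exprM t 2 2).
  have h : t ^+ 2 <= 1 / 4 by nra.
  have B0 : 0 <= B by rewrite BE; lra.
  have : 0 <= B * (t ^+ 2 * (1 / 4 - t ^+ 2)) by rewrite !mulr_ge0 ?sqr_ge0//; lra.
  have := sqr_ge0 t; lra.
have ez := expR_le_quadratic_expR y0 zy.
have z2 : z ^+ 2 <= t ^+ 4 / 4 + B ^+ 2 * t ^+ 8.
  have B0 : 0 <= B by rewrite BE; lra.
  have : 0 <= B * (t ^+ 2 * t ^+ 4) by rewrite !mulr_ge0 ?exprn_ge0.
  by rewrite /z; lra.
apply: (@le_trans _ _ (expR (s * t) * expR z * expR (a / r * t - b * t ^+ 2 / 2))).
  rewrite ler_pdivrMr ?exprn_gt0 ?ch_gt0//.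
  have /(expR_le_ch) : 0 <= t <= 1 / 2 by rewrite t0 t2.
  move=> /(lerXn2r n.+1); rewrite !nnegrE expR_ge0 (ltW (ch_gt0 _)) => /(_ isT isT).
  rewrite -expRM_natl -natr1 bE => h.
  apply: (le_trans _ (ler_wpM2l _ h)); last by rewrite !mulr_ge0 ?expR_ge0.
  by rewrite -!expRD ler_expR le_eqVlt; apply/orP; left; apply/eqP; rewrite /z BE; field; rewrite gt_eqF.
apply: (@le_trans _ _ (E * (1 + z + z ^+ 2 / 2 * expR y) *
    expR (a / r * t - b * t ^+ 2 / 2))).
  by rewrite ler_wpM2r ?expR_ge0// ler_pM ?expR_ge0.
rewrite mulrDr mulrDl lerD//; first by rewrite (mulrC E).
apply: (@le_trans _ _ (13 / 10 * ((t ^+ 4 / 4 + B ^+ 2 * t ^+ 8) / 2 * expR y) *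
    expR (a / r * t - b * t ^+ 2 / 2))).
  apply: ler_wpM2r; first exact: expR_ge0.
  apply: ler_pM => //; first by rewrite mulr_ge0 ?expR_ge0// divr_ge0 ?sqr_ge0.
  by apply: ler_wpM2r; [exact: expR_ge0|apply: ler_wpM2r].
move: (_ + B ^+ 2 * _) W0 {z2} => W W0.
rewrite (_ : _ * _ * _ = 13 / 20 * W *
  (expR y * expR (a / r * t - b * t ^+ 2 / 2))); last first.
  by move: (expR y) (expR _) => e1 e2; field.
rewrite (_ : 13 / 20 * expR _ * _ = 13 / 20 * W *
  (expR (2 * a ^+ 2) * expR (0 * t - 7 / 10 * b * t ^+ 2 / 2))); last by ring.
apply: ler_wpM2l; first by apply: mulr_ge0 => //; lra.
rewrite -!expRD ler_expR.
(* Completing the square trades the drift for [2 a^2 + b t^2 / 8]; then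
   [1/48 + 1/8 - 1/2 = -17/48 < -7/20], and the difference, multiplied by [b], covers the leftover
   [t^2 / 48]. *)
have -> : a / r * t = 2 * a ^+ 2 + b * t ^+ 2 / 8 - 2 * (a - t / (4 * r)) ^+ 2.
  have -> : b = r ^- 2 by rewrite -[RHS]mulr1 -rb mulKf// expf_neq0// gt_eqF.
  by field; rewrite gt_eqF.
have := sqr_ge0 (a - t / (4 * r)); have : 0 <= (b - 1601) * t ^+ 2 by apply: mulr_ge0; [lra|exact: sqr_ge0].
have := sqr_ge0 t; rewrite /y BE; lra.
Qed.

End discrete_kernel.

(** * Polynomial inequalities for the stopping estimate *)

(** For the remainder of [kern_le_gauss]: [c] stands for [(1 - a^2) exp (2 a^2)], [M] for
    [mom 0 0 1], [p] for [1 / sqrt (7 n / 10)], [q] for [1 / n]; 3 and 105 are the ratios of [mom 4]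
    and [mom 8] to [mom 0] at drift 0. The product of the bounds is about 8.6, rounded up to 9. *)
Lemma remainder_numeric (R : realFieldType) (c M p q r : R) :
  0 <= c -> c <= 8 / 5 -> 0 <= M -> M <= 3 / 2 -> 0 <= p -> p <= 6 / 5 * r ->
  0 <= q -> q <= 1 / 40 * (1 / 40) ->
  c * (13 / 20 * M * p * q ^+ 2 *
    (3 / 4 * (10 / 7) ^+ 2 + ((1 + q) / 12) ^+ 2 * 105 * (10 / 7) ^+ 4)) <=
  9 * r * q ^+ 2.
Proof.
move=> c0 c1 M0 M1 p0 p1 q0 q1.
have W0 : 0 <= p * q ^+ 2 by rewrite mulr_ge0// sqr_ge0.
have W1 : p * q ^+ 2 <= 6 / 5 * r * q ^+ 2 by rewrite ler_wpM2r// sqr_ge0.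
have w1 : ((1 + q) / 12) ^+ 2 <= 101 / 100 / 144.
  by move: q0 q1; clear; nra.
have := sqr_ge0 ((1 + q) / 12); move: (((1 + q) / 12) ^+ 2) w1 => w w1 w0.
set Q := 3 / 4 * (10 / 7) ^+ 2 + _.
have Q0 : 0 <= Q by rewrite /Q; move: w0; clear; lra.
have Q1 : Q <= 46 / 10 by rewrite /Q; move: w1; clear; lra.
have cM0 : 0 <= c * M by exact: mulr_ge0.
have cM1 : c * M <= 8 / 5 * (3 / 2) by exact: ler_pM.
have cMQ0 : 0 <= c * M * Q by exact: mulr_ge0.
have cMQ1 : c * M * Q <= 8 / 5 * (3 / 2) * (46 / 10) by exact: ler_pM.
have : c * M * Q * (p * q ^+ 2) <=
    8 / 5 * (3 / 2) * (46 / 10) * (6 / 5 * r * q ^+ 2) by exact: ler_pM.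
rewrite (_ : c * (13 / 20 * M * p * q ^+ 2 * Q) =
  13 / 20 * (c * M * Q * (p * q ^+ 2))); last by field.
move: (le_trans W0 W1) (c * M * Q * _).
rewrite (_ : 6 / 5 * r * q ^+ 2 = 6 / 5 * (r * q ^+ 2)); last by field.
rewrite (_ : 9 * r * q ^+ 2 = 9 * (r * q ^+ 2)); last by ring.
by move: (r * q ^+ 2); clear => w w0 x xw; lra.
Qed.

(** Powers of [a] are passed as separate bounded variables to keep the arithmetic linear. Since
    [2 K <= 5/18], the leading part is at most [- 13/18 a + a3 / 6 + 2/3 a = a3 / 6 - a / 18]; the
    other terms carry a factor [q] or [s * r] and contribute less than 9/1000. *)
Lemma stop_numeric_aux (R : realFieldType) (a a2 a3 a4 a5 q r s K : R) :
  3 / 4 <= a <= 1 -> 9 / 16 <= a2 <= 1 -> 0 <= a3 <= 1 -> 3 / 10 <= a4 <= 1 ->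
  0 <= a5 <= 1 -> 0 <= q <= 1 / 40 * (1 / 40) -> `|s * r| <= 1 / 80 -> 0 <= K <= 5 / 36 ->
  (2 * K - 1) * a + (1 + q) * ((2 * a3 + 8 * a) / 12)
      - K / 2 * q * (2 * a3 + 8 * a)
      + s * r * (- (1 + a2) + (1 + q) * (2 * a4 + 16 * a2 + 8) / 12)
      + K * q * (1 + q) * (2 * a5 + 26 * a3 + 48 * a) / 12 + 9 * q <=
  a3 / 6 - a / 18 + 9 / 100 / 10.
Proof.
move=> /andP[al au] /andP[a2l a2u] /andP[a3l a3u] /andP[a4l a4u] /andP[a5l a5u].
move=> /andP[q0 q1] sr /andP[K0 K5].
have t1 : (2 * K - 1) * a <= - (13 / 18) * a by apply: ler_wpM2r; lra.
have t2 : q * ((2 * a3 + 8 * a) / 12) <= 1 / 40 * (1 / 40) * (10 / 12).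
  by apply: ler_pM; lra.
have t3 : 0 <= K / 2 * q * (2 * a3 + 8 * a).
  by apply: mulr_ge0; [apply: mulr_ge0|]; lra.
have t4 : s * r * (- (1 + a2) + (1 + q) * (2 * a4 + 16 * a2 + 8) / 12)
    <= 1 / 80 * (17 / 100).
  have h : 0 <= q * (2 * a4 + 16 * a2 + 8) by apply: mulr_ge0; lra.
  have h' : q * (2 * a4 + 16 * a2 + 8) <= 1 / 40 * (1 / 40) * 26 by apply: ler_pM; lra.
  rewrite (le_trans (ler_norm _))// normrM.
  apply: ler_pM => //; rewrite ler_norml.
  by rewrite (mulrDl 1 q) mul1r; move: (q * _) h h' => w h h'; apply/andP; split; lra.
have t5 : K * q * (1 + q) * (2 * a5 + 26 * a3 + 48 * a) / 12 <=
    5 / 36 * (1 / 40 * (1 / 40)) * (11 / 10) * (76 / 12).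
  have Kq : 0 <= K * q by exact: mulr_ge0.
  rewrite -[leLHS]mulrA; apply: ler_pM; [| | |lra].
  - by apply: mulr_ge0 => //; lra.
  - by lra.
  - apply: ler_pM; [by []|lra| |lra].
    by apply: ler_pM.
move: t1 t2 t3 t4 t5; clear - q1.
move: (s * r * _) (K * _ * _ * _ / _) ((2 * K - 1) * a) (K / 2 * _ * _) => w1 w2 w3 w4.
rewrite (mulrDl 1 q) mul1r; move: (q * _) => w5; lra.
Qed.

(** With [d] the stopping loss and [X = a + s * r], the slack [a / 50] inside [d * X] covers the
    errors, so [E <= d * X]; then [(1 + d r^2) (1 - d r^2) <= 1]. *)
Lemma stop_numeric (R : realFieldType) (a r s K E : R) :
  3 / 4 <= a -> a < 1 -> 0 < r -> r <= 1 / 40 -> - (1 / 2) <= s -> s <= 1 / 2 ->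
  K = 5 / 9 * s ^+ 2 ->
  E = (2 * K - 1) * a + (1 + r ^+ 2) * ((2 * a ^+ 3 + 8 * a) / 12)
      - K / 2 * r ^+ 2 * (2 * a ^+ 3 + 8 * a)
      + s * r * (- (1 + a ^+ 2) + (1 + r ^+ 2) * (2 * a ^+ 4 + 16 * a ^+ 2 + 8) / 12)
      + K * r ^+ 2 * (1 + r ^+ 2) * (2 * a ^+ 5 + 26 * a ^+ 3 + 48 * a) / 12
      + 9 * r ^+ 2 ->
  (a + s * r + r ^+ 2 * E) * (1 - (a ^+ 2 / 6 - 1 / 18 + 1 / 50) * r ^+ 2) <=
  a + s * r.
Proof.
move=> a34 a1 r0 r40 sl su KE EE.
have KI : 0 <= K <= 5 / 36 by rewrite KE; apply/andP; split; nra.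
have sr : `|s * r| <= 1 / 80.
  rewrite normrM (_ : 1 / 80 = 1 / 2 * (1 / 40)); last by field.
  by apply: ler_pM => //; rewrite ler_norml; apply/andP; split; lra.
have q0 : 0 <= r ^+ 2 by exact: sqr_ge0.
have q1 : r ^+ 2 <= 1 / 40 * (1 / 40) by nra.
have qI : 0 <= r ^+ 2 <= 1 / 40 * (1 / 40) by rewrite q0 q1.
have a0 : 0 <= a by lra.
have a2l : 9 / 16 <= a ^+ 2 by nra.
have a2u : a ^+ 2 <= 1 by apply: exprn_ile1 => //; exact: ltW.
have a2I : 9 / 16 <= a ^+ 2 <= 1 by rewrite a2l.
have a3I : 0 <= a ^+ 3 <= 1 by rewrite exprn_ge0//= exprn_ile1// ltW.
have a4I : 3 / 10 <= a ^+ 4 <= 1.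
  rewrite exprn_ile1 ?(ltW a1)// andbT.
  by rewrite (exprM a 2 2); move: (a ^+ 2) a2l => y; clear; nra.
have a5I : 0 <= a ^+ 5 <= 1 by rewrite exprn_ge0//= exprn_ile1// ltW.
have aI : 3 / 4 <= a <= 1 by rewrite a34 ltW.
have := stop_numeric_aux aI a2I a3I a4I a5I qI sr KI; rewrite -EE => Ele.
set d := a ^+ 2 / 6 - 1 / 18 + 1 / 50.
have d0 : 0 <= d by rewrite /d; move: (a ^+ 2) a2l => y; clear; lra.
have d1 : d <= 14 / 100 by rewrite /d; move: (a ^+ 2) a2u => y; clear; lra.
have srl : - (1 / 80) <= s * r by move: sr; rewrite ler_norml => /andP[].
have X0 : 0 < a + s * r by move: (s * r) srl a34 => w; clear; lra.
have EX : E <= d * (a + s * r).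
  have -> : d * (a + s * r) = a ^+ 3 / 6 - a / 18 + a / 50 + d * (s * r).
    by rewrite /d; field.
  have : - (14 / 100 * (1 / 80)) <= d * (s * r).
    by move: (s * r) d d0 d1 srl => w d'; clear; nra.
  by move: (d * _) (a ^+ 3) Ele a34 => w1 w2; clear; lra.
move: (a + s * r) X0 EX => X X0 EX.
apply: (@le_trans _ _ ((X + r ^+ 2 * (d * X)) * (1 - d * r ^+ 2))).
  have dq : d * r ^+ 2 <= 14 / 100 * (1 / 40 * (1 / 40)) by exact: ler_pM.
  apply: ler_wpM2r; first by move: (d * _) dq => w; clear; lra.
  by rewrite lerD2l ler_wpM2l.
rewrite -subr_ge0 (_ : X - _ = X * (d * r ^+ 2) ^+ 2); last by ring.
by apply: mulr_ge0; [exact: ltW|exact: sqr_ge0].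
Qed.

Lemma le_inv_sqrt (R : realFieldType) (n : nat) (r : R) :
  (1600 < n)%N -> r ^+ 2 * n%:R = 1 -> r <= 1 / 40.
Proof.
move=> n16 rn; rewrite leNgt; apply/negP => r40.
have : (40 * 40)%:R <= n%:R :> R by rewrite ler_nat ltnW.
move: rn; move: (n%:R : R) => b rb; rewrite natrM => b40.
have : (r * 40) * (r * 40) <= 1.
  rewrite -[leRHS]rb (_ : _ * _ = r ^+ 2 * (40 * 40)); last by ring.
  by apply: ler_wpM2l => //; exact: sqr_ge0.
have : 1 < r * 40 by lra.
move: (r * 40) => w; nra.
Qed.

(** * Losses at the starting point and at the stopping point *)

Section start_and_stop.
Context {R : realType}.
Local Notation mu := (@lebesgue_measure R).
Local Notation half := (`[0, +oo[%classic : set R).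
Variables (a : R) (n : nat) (r : R).
Hypothesis a34 : 3 / 4 <= a < 1.
Hypothesis aE : a = (1 - a ^+ 2) * mom 0 a 1.
Hypothesis n16 : (1600 < n)%N.
Hypothesis r0 : 0 < r.
Hypothesis rn : r ^+ 2 * n%:R = 1.

Let a_ge : 3 / 4 <= a. Proof. by case/andP: a34. Qed.
Let a_lt1 : a < 1. Proof. by case/andP: a34. Qed.

Let r_le : r <= 1 / 40. Proof. exact: le_inv_sqrt n16 rn. Qed.

Let r2_le : r ^+ 2 <= r / 40. Proof. by have := r_le; have := r0; nra. Qed.

(* [47 / 2000] is slack absorbing the higher-order terms; likewise [1 / 50] in
   [stop_loss]. *)
Definition start_loss : R := (4 - a ^+ 2) / 12 + 47 / 2000.

Lemma cosh_int_start u : u * r <= a ->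
  r * mom 0 (u * r) 1 * (1 - start_loss * r ^+ 2) <= cosh_int u n.+1.
Proof.
move=> ua; apply: le_trans (cosh_int_ge_mom u n16).
have h1 := mom_start a34 aE ua.
have /mom6_le h2 : u * r <= 1 by have := a_lt1; lra.
have h3 := mom_ge0 4 (u * r) (1 : R); have h4 := mom_ge0 0 (u * r) (1 : R).
rewrite !(mom_scale _ _ r0 rn).
move: (mom 0 _ _) (mom 2 _ _) (mom 4 _ _) (mom 6 _ _) h1 h2 h3 h4 => m0 m2 m4 m6 h1 h2 h3 h4.
have B : (n%:R + 1) * r ^+ 2 = 1 + r ^+ 2 by rewrite mulrDl mul1r mulrC rn.
rewrite [leRHS](_ : _ = r * (m0 - r ^+ 2 * (m2 / 2) +
   ((n%:R + 1) * r ^+ 2) * (r ^+ 2 * m4 / 12 - 3 / 8 * r ^+ 4 * m6))); last first.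
  by move: (n%:R : R) => b; field.
rewrite B -[leLHS]mulrA; apply: ler_wpM2l; first exact: ltW.
set q := r ^+ 2; have -> : r ^+ 4 = q ^+ 2 by rewrite /q -exprM.
have q0 : 0 <= q by exact: sqr_ge0.
have q1 : q <= 1 / 40 * (1 / 40) by have := r_le; rewrite /q; have := r2_le; lra.
rewrite /start_loss.
have h5 : 0 <= q * ((4 - a ^+ 2) * m0 - (6 * m2 - m4)) by apply: mulr_ge0 => //; lra.
have qq : 0 <= q * (q * (1 + q)).
  by apply: mulr_ge0 => //; apply: mulr_ge0 => //; lra.
have h6 : 0 <= q * q * m4 by apply: mulr_ge0 => //; exact: mulr_ge0.
(* The sixth moment costs [3/8 q^2 (1 + q) * 100 m0], which for [q <= 1/1600] is at most
   [47/2000 q m0]; this is where 47/2000 comes from. *)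
have h7 : q * (1 + q) <= 47 / 2000 * (2 / 75) by nra.
have h8 : q * (q * (1 + q)) * (100 * m0 - m6) >= 0.
  by apply: mulr_ge0 => //; lra.
have h9 : 0 <= q * m0 * (47 / 2000 * (2 / 75) - q * (1 + q)).
  by apply: mulr_ge0; [exact: mulr_ge0|lra].
lra.
Qed.

Definition stop_loss : R := a ^+ 2 / 6 - 1 / 18 + 1 / 50.

(** With [y = a^2], [exp (1 - 2 y) >= 2 - 2 y] gives [(1 - y) exp (2 y) <= e / 2], and
    [e <= (4/3)^4 <= 16/5]. *)
Let C_exp : (1 - a ^+ 2) * expR (2 * a ^+ 2) <= 8 / 5.
Proof.
have e1 : expR 1 <= 16 / 5 :> R.
  have -> : 1 = 4%:R * (1 / 4) :> R by field.
  rewrite expRM_natl; have := @expR_quarter_le R (1 / 4) (lexx _).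
  have := expR_ge0 (1 / 4 : R); set e := expR _ => h0 h1.
  apply: (@le_trans _ _ ((4 / 3) ^+ 4)); last by lra.
  by rewrite lerXn2r ?nnegrE//; lra.
have pq : expR (1 - 2 * a ^+ 2) * expR (2 * a ^+ 2) = expR 1.
  by rewrite -expRD subrK.
have := expR_gt0 (2 * a ^+ 2); have := expR_ge1Dx (1 - 2 * a ^+ 2).
move: pq e1; set y := a ^+ 2; move: (expR (1 - 2 * y)) (expR (2 * y)) (expR 1).
by move: y => y p q e <- e1 h q0; nra.
Qed.

Lemma cosh_int_le_mom (s B K : R) : `|s| <= 1 / 2 ->
  B = (n%:R + 1) / 12 -> K = 5 / 9 * s ^+ 2 ->
  cosh_int (a / r + s) n.+1 <=
    mom 0 (a / r) n%:R + s * mom 1 (a / r) n%:R + (K - 1 / 2) * mom 2 (a / r) n%:R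
    - s / 2 * mom 3 (a / r) n%:R + (B - K / 2) * mom 4 (a / r) n%:R
    + s * B * mom 5 (a / r) n%:R + B * K * mom 6 (a / r) n%:R
    + 13 / 20 * expR (2 * a ^+ 2) *
      (mom 4 0 (7 / 10 * n%:R) / 4 + B ^+ 2 * mom 8 0 (7 / 10 * n%:R)).
Proof.
move=> s2 BE KE.
have b0 : 0 < n%:R :> R by rewrite ltr0n; apply: leq_ltn_trans n16.
have b7 : 0 < 7 / 10 * n%:R :> R by rewrite mulr_gt0.
pose c k := nth 0 [:: 1; s; K - 1 / 2; - (s / 2); B - K / 2; s * B; B * K] k.
pose e k := 13 / 20 * expR (2 * a ^+ 2) * nth 0 [:: 0; 0; 0; 0; 1 / 4; 0; 0; 0; B ^+ 2] k.
rewrite [leRHS](_ : _ = \sum_(k < 7) c k * mom k (a / r) n%:R +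
    \sum_(k < 9) e k * mom k 0 (7 / 10 * n%:R)); last first.
  rewrite !big_ord_recr !big_ord0/= /c /e/=.
  move: (mom 0 _ _) (mom 1 _ _) (mom 2 _ _) (mom 3 _ _) (mom 4 (a / r) _)
    (mom 5 _ _) (mom 6 _ _) (expR _) => m0 m1 m2 m3 m4 m5 m6 E.
  rewrite !(mul0r, mulr0, add0r, addr0).
  by move: (mom 4 _ _) (mom 8 _ _) => m4' m8'; ring.
rewrite -!Rintegral_gauss_mono_sum// -RintegralD//; try exact: integrable_gauss_mono_sum.
apply: le_Rintegral => //.
- exact: integrable_kern.
- exact: (integrableD _ (integrable_gauss_mono_sum _ _ _ _) (integrable_gauss_mono_sum _ _ _ _)).
move=> t; rewrite /= in_itv/= andbT => t0.
rewrite (le_trans (@kern_le_gauss _ a r s B K n t n16 BE KE r0 rn s2 t0))//.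
rewrite !big_ord_recr !big_ord0/= /c /e/= /gauss_mono.
rewrite le_eqVlt; apply/orP; left; apply/eqP.
rewrite !(mul0r, mulr0, add0r, addr0).
by move: (expR (2 * _)) (expR (- _)) (expR (_ - _)) => E1 E2 E3; ring.
Qed.

(** After scaling, the moments of order 0 and 1 reproduce the payoff [r (a + s r)] exactly, by
    smooth fit. The rest is [r^3 E], where the overshoot term [K] is set against the [- 1/2] that
    stems from the surplus factor [ch t]. *)
Lemma cosh_int_stop (s : R) : `|s| <= 1 / 2 ->
  (1 - a ^+ 2) * cosh_int (a / r + s) n.+1 * (1 - stop_loss * r ^+ 2) <=
  (a / r + s) * r ^+ 2.
Proof.
move=> s2; have [sl su] : - (1 / 2) <= s /\ s <= 1 / 2 by apply/andP; rewrite -ler_norml.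
set K := 5 / 9 * s ^+ 2; set B : R := (n%:R + 1) / 12.
pose C := 1 - a ^+ 2.
have C0 : 0 < C by rewrite /C; have := a_ge; have := a_lt1; nra.
have b0 : 0 < n%:R :> R by rewrite ltr0n; apply: leq_ltn_trans n16.
have ar : a / r * r = a by rewrite divfK// gt_eqF.
(* The scale of the weakened Gaussian of parameter [7/10 n]; [p <= 6/5 r] since [10/7 <= 36/25]. *)
pose p := r / Num.sqrt (7 / 10).
have s7 : 0 < Num.sqrt (7 / 10) :> R by rewrite sqrtr_gt0; lra.
have p0 : 0 < p by exact: divr_gt0.
have p2 : p ^+ 2 = r ^+ 2 * (10 / 7).
  by rewrite /p exprMn exprVn sqr_sqrtr; [field|lra].
have pn : p ^+ 2 * (7 / 10 * n%:R) = 1.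
  by rewrite p2 -[RHS]rn; move: (n%:R : R) => b; field.
have pr : p <= 6 / 5 * r.
  have r6 : 0 <= 6 / 5 * r by apply: mulr_ge0; [lra|exact: ltW].
  rewrite -(@ler_pXn2r _ 2)// ?nnegrE ?(ltW p0)//.
  by rewrite p2; have := sqr_ge0 r; lra.
have M1 : (1 - a ^+ 2) * mom 0 a 1 = a by rewrite -aE.
have m0 : C * mom 0 a 1 = a by [].
have CD (x k v w : R) : C * (x * v + k * w) = x * (C * v) + k * (C * w) by ring.
have m1 : C * mom 1 a 1 = 1 by rewrite mom1E mulrDr mulrCA m0 /C; ring.
have m2 : C * mom 2 a 1 = 2 * a by rewrite momSSE CD m1 m0; ring.
have m3 : C * mom 3 a 1 = 2 + 2 * a ^+ 2 by rewrite momSSE CD m2 m1; ring.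
have m4 : C * mom 4 a 1 = 2 * a ^+ 3 + 8 * a by rewrite momSSE CD m3 m2; ring.
have m5 : C * mom 5 a 1 = 2 * a ^+ 4 + 16 * a ^+ 2 + 8.
  by rewrite momSSE CD m4 m3; ring.
have m6 : C * mom 6 a 1 = 2 * a ^+ 5 + 26 * a ^+ 3 + 48 * a.
  by rewrite momSSE CD m5 m4; ring.
have Bq : B * r ^+ 2 = (1 + r ^+ 2) / 12.
  by rewrite /B mulrAC mulrDl mul1r (mulrC n%:R) rn.
set q := r ^+ 2.
have q0 : 0 <= q by exact: sqr_ge0.
have q1 : q <= 1 / 40 * (1 / 40) by rewrite /q; have := r_le; have := r2_le; lra.
pose rem := 13 / 20 * expR (2 * a ^+ 2) *
      (mom 4 0 (7 / 10 * n%:R) / 4 + B ^+ 2 * mom 8 0 (7 / 10 * n%:R)).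
have remE : C * rem <= 9 * r * q ^+ 2.
  have [M0 M32] := andP (@mom0_bounds R).
  have z4 : mom 4 0 (1 : R) = 3 * mom 0 0 1.
    by rewrite !momSSE; ring.
  have z8 : mom 8 0 (1 : R) = 105 * mom 0 0 1.
    by rewrite !momSSE; ring.
  rewrite /rem {rem} (mom_scale 4 _ p0 pn) (mom_scale 8 _ p0 pn) mul0r z4 z8.
  move: (mom 0 0 1) M0 M32 => M M0 M32.
  have -> : p ^+ 5 = p * (q * (10 / 7)) ^+ 2 by rewrite -p2; ring.
  have -> : p ^+ 9 = p * (q * (10 / 7)) ^+ 4 by rewrite -p2; ring.
  move: B Bq => B Bq.
  rewrite (_ : C * _ = (C * expR (2 * a ^+ 2)) * (13 / 20 * M * p * q ^+ 2 *
    (3 / 4 * (10 / 7) ^+ 2 + (B * q) ^+ 2 * 105 * (10 / 7) ^+ 4))); last first.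
    by move: (expR _) => e; field.
  rewrite Bq -/q; apply: remainder_numeric => //; [|exact: le_trans M0|exact: ltW].
  by rewrite mulr_ge0 ?expR_ge0// ltW.
pose E := (2 * K - 1) * a + (1 + r ^+ 2) * ((2 * a ^+ 3 + 8 * a) / 12)
      - K / 2 * r ^+ 2 * (2 * a ^+ 3 + 8 * a)
      + s * r * (- (1 + a ^+ 2) + (1 + r ^+ 2) * (2 * a ^+ 4 + 16 * a ^+ 2 + 8) / 12)
      + K * r ^+ 2 * (1 + r ^+ 2) * (2 * a ^+ 5 + 26 * a ^+ 3 + 48 * a) / 12
      + 9 * r ^+ 2.
have CJ : C * cosh_int (a / r + s) n.+1 <= r * (a + s * r + r ^+ 2 * E).
  apply: (le_trans (ler_wpM2l (ltW C0) (cosh_int_le_mom s2 (erefl B) (erefl K)))).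
  rewrite mulrDr -/rem.
  rewrite !(mom_scale _ _ r0 rn) ar.
  apply: (@le_trans _ _ (r * (a + s * r + (K - 1 / 2) * q * (2 * a)
     - s / 2 * r * q * (2 + 2 * a ^+ 2) + (B * q) * q * (2 * a ^+ 3 + 8 * a)
     - K / 2 * q ^+ 2 * (2 * a ^+ 3 + 8 * a)
     + s * (B * q) * (r * q) * (2 * a ^+ 4 + 16 * a ^+ 2 + 8)
     + (B * q) * K * q ^+ 2 * (2 * a ^+ 5 + 26 * a ^+ 3 + 48 * a)) + 9 * r * q ^+ 2)).
    rewrite lerD// le_eqVlt; apply/orP; left; apply/eqP.
    rewrite -m6 -m5 -m4 -m3 -m2 -[in a + s * r]m0 -[s * r]mulr1 -[in s * r * _]m1.
    rewrite /q; move: (mom 0 _ _) (mom 1 _ _) (mom 2 _ _) (mom 3 _ _) (mom 4 _ _)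
      (mom 5 _ _) (mom 6 _ _) => m0' m1' m2' m3' m4' m5' m6'.
    by field.
  rewrite Bq -/q /E -/q le_eqVlt; apply/orP; left; apply/eqP; rewrite /q.
  by field.
have N := stop_numeric a_ge a_lt1 r0 r_le sl su (erefl K) (erefl E).
have -> : (a / r + s) * r ^+ 2 = r * (a + s * r) by field; rewrite gt_eqF.
apply: (@le_trans _ _ (r * (a + s * r + r ^+ 2 * E) * (1 - stop_loss * r ^+ 2))).
  apply: ler_wpM2r => //; rewrite /stop_loss -/q.
  have : a ^+ 2 <= 1 by have := a_ge; have := a_lt1; nra.
  by have := sqr_ge0 a; nra.
by rewrite -mulrA; apply: ler_wpM2l; [exact: ltW|exact: N].
Qed.

End start_and_stop.

(** * The threshold strategy with a finite horizon *)

Section threshold_game.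
Context {R : realType}.
Local Notation sqrtn b := (Num.sqrt (b%:R : R)).
Implicit Types (u e : R) (b N : nat).

(** Expected payoff of the rule [D] with a forced stop after [N] steps, written as a recursion on
    reals so that the comparison with [cosh_int] is a plain induction, free of conditional
    expectations. *)
Fixpoint game (D : R -> nat -> bool) (N : nat) (u : R) (b : nat) : R :=
  if N is N'.+1 then
    if D u b then u / b%:R
    else 2^-1 * (game D N' (u + 1) b.+1 + game D N' (u - 1) b.+1)
  else u / b%:R.

Variable a : R.
Hypothesis a34 : 3 / 4 <= a < 1.
Hypothesis aE : a = (1 - a ^+ 2) * mom 0 a 1.

Let a_ge : 3 / 4 <= a. Proof. by case/andP: a34. Qed.
Let a_lt1 : a < 1. Proof. by case/andP: a34. Qed.

Definition stop_rule (u : R) (b : nat) : bool := a * sqrtn b - 1 / 2 <= u.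

(* With [s = sqrt (b + N)], at the horizon [(1 - a^2) * cosh_int <= 4 / s] and
   [4 / s - y / s^2 <= (y^2 / s + 5 s) / s^2]; averaging over the remaining
   steps turns [y^2] into [u^2 + N]. *)
Definition horizon_error (N : nat) (u : R) (b : nat) : R :=
  ((u ^+ 2 + N%:R) / sqrtn (b + N)%N + 5 * sqrtn (b + N)%N) / (b + N)%:R.

Lemma horizon_errorS N u b : horizon_error N.+1 u b =
  2^-1 * (horizon_error N (u + 1) b.+1 + horizon_error N (u - 1) b.+1).
Proof.
rewrite /horizon_error !addSnnS -(natr1 N).
move: (N%:R : R) ((b + N.+1)%:R : R) (Num.sqrt _) => n m s.
by rewrite -mulrDl mulrA; congr (_ / _); move: s^-1 => s'; field.
Qed.

Lemma horizon_error_ge0 N u b : 0 <= horizon_error N u b.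
Proof.
by rewrite /horizon_error divr_ge0// addr_ge0 ?divr_ge0 ?mulr_ge0 ?sqrtr_ge0 ?addr_ge0 ?sqr_ge0.
Qed.

Let C := 1 - a ^+ 2.

Let C0 : 0 < C.
Proof. by rewrite /C; have := a_ge; have := a_lt1; nra. Qed.

Let rsqrt (b : nat) : R := (sqrtn b)^-1.

Let rsqrt_gt0 b : (1600 < b)%N -> 0 < rsqrt b.
Proof. by move=> b16; rewrite invr_gt0 sqrtr_gt0 ltr0n (leq_ltn_trans _ b16). Qed.

Let rsqrt2 b : (1600 < b)%N -> rsqrt b ^+ 2 = b%:R^-1.
Proof. by move=> b16; rewrite exprVn sqr_sqrtr. Qed.

Let rsqrt2M b : (1600 < b)%N -> rsqrt b ^+ 2 * b%:R = 1.
Proof.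
by move=> b16; rewrite rsqrt2// mulVf// pnatr_eq0 -lt0n (leq_ltn_trans _ b16).
Qed.

Let rsqrt_le b : (1600 < b)%N -> rsqrt b <= 1 / 40.
Proof. by move=> b16; exact: le_inv_sqrt b16 (rsqrt2M b16). Qed.

Let stop_loss_ge0 : 0 <= stop_loss a.
Proof. by rewrite /stop_loss; have := a_ge; nra. Qed.

Let stop_loss_le : stop_loss a <= 1 / 2.
Proof. by rewrite /stop_loss; have := a_ge; have := a_lt1; nra. Qed.

Lemma cosh_int_stop_nat b u : (1600 < b)%N -> `|u - a * sqrtn b| <= 1 / 2 ->
  C * cosh_int u b.+1 * (1 - stop_loss a / b%:R) <= u / b%:R.
Proof.
move=> b16 ub.
have := cosh_int_stop a34 aE b16 (rsqrt_gt0 b16) (rsqrt2M b16) ub.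
by rewrite {1 2}/rsqrt invrK !(addrC (a * _)) subrK -/(rsqrt b) (rsqrt2 b16).
Qed.

(** [cosh_int] grows with [u], so the top of the strip decides. There the stopping estimate bounds
    it by [rsqrt b * (a + rsqrt b / 2) <= 2 * rsqrt b], up to a loss factor that is at least 1/2. *)
Lemma cosh_int_le_sqrt b u : (1600 < b)%N -> u <= a * sqrtn b + 1 / 2 ->
  C * cosh_int u b.+1 <= 4 * rsqrt b.
Proof.
move=> b16 ub.
have r0 := rsqrt_gt0 b16; have r40 := rsqrt_le b16.
have := @cosh_int_stop_nat b (a * sqrtn b + 1 / 2) b16.
rewrite addrAC subrr add0r ger0_norm// => /(_ (lexx _)).
have : C * cosh_int u b.+1 <= C * cosh_int (a * sqrtn b + 1 / 2) b.+1.
  by apply: ler_wpM2l; [exact: ltW|exact: le_cosh_int].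
have sE : sqrtn b = (rsqrt b)^-1 by rewrite /rsqrt invrK.
rewrite -(rsqrt2 b16) sE.
have : 0 <= C * cosh_int (a * (rsqrt b)^-1 + 1 / 2) b.+1.
  by apply: mulr_ge0; [exact: ltW|exact: cosh_int_ge0].
rewrite (_ : (a * (rsqrt b)^-1 + 1 / 2) * rsqrt b ^+ 2 = rsqrt b * (a + rsqrt b / 2)).
  move: (C * cosh_int _ _) (C * cosh_int _ _) => y x x0 xy h.
  suff : 1 / 2 * x <= rsqrt b * 2.
    by lra.
  apply: le_trans (le_trans h _).
    rewrite (mulrC (1 / 2)); apply: ler_wpM2l => //.
    have : stop_loss a * rsqrt b ^+ 2 <= 1 / 2 * 1.
      apply: ler_pM => //; first exact: sqr_ge0.
      by rewrite exprn_ile1 ?ltW//; lra.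
    lra.
  by apply: ler_wpM2l; [exact: ltW|have := a_lt1; lra].
by field; rewrite gt_eqF.
Qed.

(** The loss factor is frozen at the initial time [b0]: later losses [stop_loss a / b] are smaller,
    and a constant factor passes through the martingale average. The strip is preserved because a
    state that does not stop lies below [a sqrt b - 1/2] and the curve increases. *)
Lemma game_ge b0 N b u : (1600 < b0)%N -> (b0 <= b)%N ->
  u <= a * sqrtn b + 1 / 2 ->
  (1 - stop_loss a / b0%:R) * (C * cosh_int u b.+1) - horizon_error N u b <=
    game stop_rule N u b.
Proof.
move=> b016; elim: N b u => [|N IHN] b u b0b ub.
  have b16 := leq_trans b016 b0b.
  have b0' : 0 < b%:R :> R by rewrite ltr0n (leq_ltn_trans _ b16).
  have s0 : 0 < sqrtn b :> R by rewrite sqrtr_gt0.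
  have h := cosh_int_le_sqrt b16 ub.
  have h0 : 0 <= C * cosh_int u b.+1.
    by apply: mulr_ge0; [exact: ltW|exact: cosh_int_ge0].
  have h1 : (1 - stop_loss a / b0%:R) * (C * cosh_int u b.+1) <= 4 * rsqrt b.
    apply: le_trans h; rewrite ler_piMl// gerBl divr_ge0//.
  rewrite /= /horizon_error addn0 addr0 lerBlDr -mulrDl.
  apply: (le_trans h1); rewrite ler_pdivlMr//.
  have sb : b%:R = sqrtn b * sqrtn b by rewrite -expr2 sqr_sqrtr// ltW.
  rewrite [X in _ * X <= _]sb.
  rewrite mulrA /rsqrt mulfVK ?gt_eqF// {sb}.
  move: (sqrtn b) s0 => s s0.
  rewrite -subr_ge0 (_ : _ - _ = ((u + s / 2) ^+ 2 + 3 / 4 * s ^+ 2) / s).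
    apply: divr_ge0; last exact: ltW.
    by apply: addr_ge0; [|apply: mulr_ge0; [lra|]]; exact: sqr_ge0.
  by field; rewrite gt_eqF.
have b16 := leq_trans b016 b0b.
rewrite /=; case: ifPn => [D|D].
  apply: (@le_trans _ _ ((1 - stop_loss a / b%:R) * (C * cosh_int u b.+1))).
    rewrite lerBlDr -[leLHS]addr0 lerD ?horizon_error_ge0//.
    apply: ler_wpM2r.
      by apply: mulr_ge0; [exact: ltW|exact: cosh_int_ge0].
    rewrite lerD2l lerN2 ler_wpM2l// lef_pV2 ?posrE ?ltr0n ?(leq_ltn_trans _ b16) ?(leq_ltn_trans _ b016)//.
    by rewrite ler_nat.
  rewrite (mulrC (1 - _)); apply: cosh_int_stop_nat => //; rewrite ler_norml.
  by move: D; rewrite /stop_rule => D; apply/andP; split; lra.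
move: D; rewrite /stop_rule -ltNge => D.
have sb : a * sqrtn b <= a * sqrtn b.+1 :> R.
  by apply: ler_wpM2l; [have := a_ge; lra|rewrite ler_wsqrtr// ler_nat].
have h1 : u + 1 <= a * sqrtn b.+1 + 1 / 2 by lra.
have h2 : u - 1 <= a * sqrtn b.+1 + 1 / 2 by lra.
have := IHN b.+1 (u + 1) (leqW b0b) h1; have := IHN b.+1 (u - 1) (leqW b0b) h2.
rewrite horizon_errorS (cosh_int_average u b.+1).
move: (game _ _ _ _) (game _ _ _ _) (horizon_error _ _ _) (horizon_error _ _ _)
  (cosh_int _ _) (cosh_int _ _) (1 - stop_loss a / _).
by move=> *; lra.
Qed.

(** With [m = b + N >= 1] the numerator is at most [(u^2 + 6) m / sqrt m], so the error is at most
    [(u^2 + 6) / sqrt m]. *)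
Lemma horizon_error_small u b e : (0 < b)%N -> 0 < e ->
  exists N, horizon_error N u b <= e.
Proof.
move=> b0 e0; pose c := u ^+ 2 + 1 + 5.
have c0 : 0 < c by rewrite /c; have := sqr_ge0 u; lra.
have [N Nc] : exists N : nat, (c / e) ^+ 2 <= N%:R.
  by exists (Num.bound ((c / e) ^+ 2)); rewrite ltW// archi_boundP// sqr_ge0.
exists N; rewrite /horizon_error.
have m1 : 1 <= (b + N)%:R :> R by rewrite (ler_nat _ 1) addn_gt0 b0.
have mN : N%:R <= (b + N)%:R :> R by rewrite ler_nat leq_addl.
have s0 : 0 < sqrtn (b + N)%N :> R by rewrite sqrtr_gt0; lra.
have sm : sqrtn (b + N)%N ^+ 2 = (b + N)%:R :> R by rewrite sqr_sqrtr//; lra.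
move: (N%:R : R) ((b + N)%:R : R) (Num.sqrt _) m1 mN s0 sm Nc => n m s m1 mN s0 sm Nc.
have sc : c / e <= s.
  rewrite -(@ler_pXn2r _ 2)// ?nnegrE ?(ltW s0)// ?sm; first exact: le_trans mN.
  by rewrite divr_ge0// ltW.
apply: (@le_trans _ _ (c / s)); last first.
  by rewrite ler_pdivrMr// mulrC -ler_pdivrMr.
rewrite -sm ler_pdivrMr ?exprn_gt0// (_ : c / s * s ^+ 2 = (c * m) / s); last first.
  by rewrite -sm; field; rewrite gt_eqF.
rewrite (_ : 5 * s = 5 * m / s); last by rewrite -sm; field; rewrite gt_eqF.
rewrite -mulrDl ler_wpM2r ?invr_ge0 ?(ltW s0)// /c.
by have := sqr_ge0 u; nra.
Qed.

Lemma game_start b u e : (1600 < b)%N -> u <= a * sqrtn b -> 0 < e ->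
  exists N, C * mom 0 u b%:R * (1 - 5 / (12 * b%:R) * (1 + (sqrtn b)^-1)) - e
    <= game stop_rule N u b.
Proof.
move=> b16 ub e0; have b0 := leq_ltn_trans (leq0n _) b16.
have [N Ne] := horizon_error_small u b0 e0; exists N.
have /(game_ge N b16 (leqnn b)) : u <= a * sqrtn b + 1 / 2 by lra.
apply: le_trans; apply: lerB => //.
have r0 := rsqrt_gt0 b16; have r40 := rsqrt_le b16.
have ur : u * rsqrt b <= a by rewrite ler_pdivrMr ?sqrtr_gt0 ?ltr0n.
have J := cosh_int_start a34 aE b16 r0 (rsqrt2M b16) ur.
rewrite (mom_scale _ _ r0 (rsqrt2M b16)) expr1.
have q0 : 0 <= rsqrt b ^+ 2 by exact: sqr_ge0.
have q1 : rsqrt b ^+ 2 <= 1 by rewrite exprn_ile1 ?(ltW r0)//; lra.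
rewrite (_ : 5 / (12 * b%:R) = 5 / 12 * rsqrt b ^+ 2); last first.
  by rewrite (rsqrt2 b16) invfM mulrA.
rewrite -/(rsqrt b) -(rsqrt2 b16).
apply: (@le_trans _ _ ((1 - stop_loss a * rsqrt b ^+ 2) *
   (C * (rsqrt b * mom 0 (u * rsqrt b) 1 * (1 - start_loss a * rsqrt b ^+ 2))))); last first.
  apply: ler_wpM2l; first by move: stop_loss_ge0 stop_loss_le; nra.
  by apply: ler_wpM2l; [exact: ltW|].
rewrite (_ : (1 - stop_loss a * rsqrt b ^+ 2) * (C * _) = C * (rsqrt b * mom 0 (u * rsqrt b) 1) *
  ((1 - stop_loss a * rsqrt b ^+ 2) * (1 - start_loss a * rsqrt b ^+ 2))); last by ring.
apply: ler_wpM2l.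
  by apply: mulr_ge0; [exact: ltW|apply: mulr_ge0; [exact: ltW|exact: mom_ge0]].
have l0 : 0 <= stop_loss a * start_loss a.
  by apply: mulr_ge0 => //; rewrite /start_loss; have := a_ge; have := a_lt1; nra.
(* [13/36 + 1/50 + 47/2000 <= 5/12], using [a^2 < 1]. *)
have l1 : stop_loss a + start_loss a <= 5 / 12.
  by rewrite /stop_loss /start_loss; have := a_ge; have := a_lt1; nra.
move: (rsqrt b ^+ 2) q0 q1 => q q0 q1.
have h1 : 0 <= stop_loss a * start_loss a * q ^+ 2 by rewrite mulr_ge0 ?sqr_ge0.
have h2 : 0 <= 5 / 12 * q * rsqrt b by apply: mulr_ge0; [lra|exact: ltW].
have h3 : (stop_loss a + start_loss a) * q <= 5 / 12 * q by exact: ler_wpM2r.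
lra.
Qed.

End threshold_game.

(** * Realization of the recursion by stopping times of the walk *)

Section walk_value.
Context {R : realType} {d : measure_display} {Omega : measurableType d}.
Variables (P : probability Omega R) (X : nat -> {RV P >-> R}).
Hypothesis hX : fair_coin_steps X.
Implicit Types (e : seq R) (u : R) (b k n N : nat) (w : Omega).

Definition cylinder e : set Omega :=
  [set w | forall i, (i < size e)%N -> X i w = nth 0 e i].

Definition is_sign (x : R) := (x == 1) || (x == -1).

Lemma cylinder_rcons e x :
  cylinder (rcons e x) = cylinder e `&` X (size e) @^-1` [set x].
Proof.
apply/seteqP; split => [w We|w [We Wx] i].
  split=> [i ie|/=].
    have := We i; rewrite size_rcons nth_rcons ie ltnS => ->//.
    exact: ltnW.
  by have := We (size e); rewrite size_rcons nth_rcons ltnn eqxx => ->.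
rewrite size_rcons nth_rcons ltnS leq_eqVlt => /orP[/eqP->|ie].
  by rewrite ltnn eqxx.
by rewrite ie We.
Qed.

Lemma measurable_cylinder e : measurable (cylinder e).
Proof.
elim/last_ind: e => [|e x IHe].
  by rewrite (_ : cylinder _ = setT)//; apply/seteqP; split.
by rewrite cylinder_rcons; exact: measurableI.
Qed.

Lemma probability_cylinder e : all is_sign e -> P (cylinder e) = ((2^-1) ^+ size e)%:E.
Proof.
move=> se; have [ind fair] := hX.
have := ind (iota 0 (size e)) (fun i => [set nth 0 e i]) (iota_uniq _ _).
move=> /(_ (fun i => measurable_set1 _)).
rewrite (_ : \bigcap_(i in _) _ = cylinder e); last first.
  apply/seteqP; split => w /= We i.
    by move=> ie; apply: We; rewrite /= mem_iota.
  by rewrite /= mem_iota add0n => /andP[_ ie]; apply: We.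
move=> ->; rewrite big_seq (eq_bigr (fun=> (2^-1)%:E)); last first.
  move=> i; rewrite mem_iota add0n => /andP[_ ie].
  have /orP[/eqP->|/eqP->] := allP se _ (mem_nth 0 ie); by have [] := fair i.
rewrite -big_seq; suff H m j :
  (\prod_(i <- iota j m) (2^-1)%:E = ((2^-1) ^+ m)%:E :> \bar R)%E by [].
elim: m j => [|m IHm] j; first by rewrite big_nil.
by rewrite /= big_cons IHm exprS EFinM.
Qed.

Lemma walk_cylinder e w : cylinder e w -> walk X (size e) w = \sum_(x <- e) x.
Proof.
move=> We; rewrite /walk (big_nth 0) big_mkord; apply: eq_bigr => i _.
exact: We.
Qed.

(** The steps are signs only almost surely; [Z] collects the outcomes of the cylinder whose next
    step has another value. *)
Lemma cylinder_split e : exists2 Z : set Omega, measurable Z /\ P Z = 0%E &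
  [/\ cylinder e = (cylinder (rcons e 1) `|` cylinder (rcons e (-1))) `|` Z,
   [disjoint cylinder (rcons e 1) & cylinder (rcons e (-1))] &
   [disjoint cylinder (rcons e 1) `|` cylinder (rcons e (-1)) & Z] ].
Proof.
have [_ /(_ (size e)) [p1 pN1]] := hX.
pose S (x : R) := X (size e) @^-1` [set x].
have mS x : measurable (S x).
  by rewrite /S -[X in measurable X]setTI; exact: measurable_funP.
have d1 : (S 1 `&` S (-1) = set0)%classic.
  apply/seteqP; split => // w []; rewrite /S /= => -> /eqP.
  by rewrite -subr_eq0 opprK; apply/negP; rewrite (_ : 1 + 1 = 2 :> R)// pnatr_eq0.
exists (cylinder e `\` (S 1 `|` S (-1))).
  split; first by apply: measurableD; [exact: measurable_cylinder|exact: measurableU].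
  apply/eqP; rewrite eq_le measure_ge0 andbT.
  apply: (@le_trans _ _ (P (~` (S 1 `|` S (-1))))).
    apply: le_measure; rewrite ?inE.
    - by apply: measurableD; [exact: measurable_cylinder|exact: measurableU].
    - by apply: measurableC; exact: measurableU.
    - by move=> w [].
  rewrite probability_setC; last exact: measurableU.
  rewrite [X in (1 - X)%E](_ : _ = 1%E); first by rewrite subee.
  apply: (etrans (measureU P (mS 1) (mS (-1)) d1)).
  apply: (etrans (congr2 _ p1 pN1)); rewrite -EFinD; congr EFin; by field.
rewrite !cylinder_rcons -/(S 1) -/(S (-1)); split.
- rewrite -setIUr; apply/seteqP; split => [w We|w [[]|[]]//].
  by have [Sw|Sw] := pselect ((S 1 `|` S (-1)) w); [left|right].
- by apply/disj_setPS => w [[_ h1] [_ h2]]; rewrite -d1.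
- by apply/disj_setPS => w [[[_ h1]|[_ h1]] [_ h2]]; apply: h2; [left|right].
Qed.

Variable D : R -> nat -> bool.
Hypothesis mD : forall b, measurable [set u | D u b].
Variables (u : R) (b : nat).

Lemma measurable_walk k : measurable_fun setT (walk X k).
Proof. by apply: measurable_sum => i; exact: measurable_funP. Qed.

(** [k] is the current time and [N] the number of steps left before the forced stop. *)
Fixpoint rule_time N k w : nat :=
  if N is N'.+1 then
    if D (u + walk X k w) (b + k) then k else rule_time N' k.+1 w
  else k.

Lemma rule_time_ge N k w : (k <= rule_time N k w)%N.
Proof.
elim: N k => [|N IHN] k //=; case: ifP => // _.
exact: leq_trans (leqnSn _) (IHN _).
Qed.

Definition rule_payoff N k w : R :=
  (u + walk X (rule_time N k w) w) / (b + rule_time N k w)%:R.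

Lemma measurable_rule_event k :
  measurable [set w | D (u + walk X k w) (b + k)].
Proof.
rewrite (_ : [set w | _] = setT `&` (fun w => u + walk X k w) @^-1` [set v | D v (b + k)%N]).
  have : measurable_fun setT (fun w => u + walk X k w).
    by apply: measurable_funD => //; exact: measurable_walk.
  exact.
by rewrite setTI.
Qed.

Lemma measurable_rule_payoff N k : measurable_fun setT (rule_payoff N k).
Proof.
rewrite /rule_payoff; elim: N k => [|N IHN] k /=.
  by apply: measurable_funM => //; apply: measurable_funD => //; exact: measurable_walk.
rewrite (_ : (fun w => _) = (fun w => if D (u + walk X k w) (b + k)
    then (u + walk X k w) / (b + k)%:R else rule_payoff N k.+1 w)); last first.
  by apply/funext => w; case: ifP.
apply: measurable_fun_ifT.
- apply: (measurable_fun_bool true).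
  rewrite setTI (_ : _ @^-1` _ = [set w | D (u + walk X k w) (b + k)])//.
  exact: measurable_rule_event.
- by apply: measurable_funM => //; apply: measurable_funD => //; exact: measurable_walk.
- exact: IHN.
Qed.

(** On a cylinder of signs the walk is known up to time [size e], so the decision at that time is
    constant there: either the rule stops, or the cylinder splits into two halves, which is the
    recursion of [game]. *)
Lemma integral_rule_payoff N e : all is_sign e ->
  (\int[P]_(w in cylinder e) (rule_payoff N (size e) w)%:E =
   ((2^-1) ^+ size e * game D N (u + \sum_(x <- e) x) (b + size e))%:E)%E.
Proof.
have constant_case e' (f : Omega -> R) : all is_sign e' ->
    (forall w, cylinder e' w ->
      f w = (u + walk X (size e') w) / (b + size e')%:R) ->
    (\int[P]_(w in cylinder e') (f w)%:E =
    ((2^-1) ^+ size e' * ((u + \sum_(x <- e') x) / (b + size e')%:R))%:E)%E.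
  move=> se fE.
  under eq_integral => w /[!inE] We do rewrite fE// walk_cylinder//.
  rewrite integral_cst; last exact: measurable_cylinder.
  apply: (etrans (congr1 (mule _) (probability_cylinder se))).
  by rewrite -EFinM mulrC.
elim: N e => [|N IHN] e se; first exact: constant_case.
rewrite /=; case: ifPn => Du.
  apply: constant_case => // w We; rewrite /rule_payoff /=.
  by rewrite walk_cylinder// Du walk_cylinder.
have [Z [mZ Z0] [eE dj1 dj2]] := cylinder_split e.
have mc x := measurable_cylinder (rcons e x).
have mf A N' k : measurable_fun A (fun w => (rule_payoff N' k w)%:E).
  by apply/measurable_EFinP; apply: measurable_funTS; exact: measurable_rule_payoff.
rewrite {1}eE integral_setU//; last exact: measurableU.
rewrite [X in (_ + X)%E]null_set_integral// adde0 integral_setU//.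
have step x : is_sign x ->
    (\int[P]_(w in cylinder (rcons e x)) (rule_payoff N.+1 (size e) w)%:E =
    ((2^-1) ^+ (size e).+1 *
       game D N (u + \sum_(y <- e) y + x) (b + size e).+1)%:E)%E.
  move=> sx.
  have := IHN (rcons e x); rewrite all_rcons sx se size_rcons => /(_ isT).
  rewrite -cats1 big_cat big_seq1 addrA addnS => <-.
  apply: eq_integral => w; rewrite inE cats1 cylinder_rcons => -[We _].
  by rewrite /rule_payoff /= walk_cylinder// (negbTE Du).
rewrite !step ?/is_sign ?eqxx ?orbT// -EFinD; congr EFin.
by rewrite exprS; ring.
Qed.

Lemma rule_stopping_time N :
  walk_stopping_time X (fun w => Some (rule_time N 0 w)).
Proof.
split=> [n|]; last by apply: aeW => w.
pose G := \bigcup_(i in [set j | (j <= n)%N])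
  preimage_set_system setT (walk X i) measurable.
suff H k : @measurable _ (g_sigma_algebraType G) [set w | rule_time N k w = n].
  rewrite (_ : [set w | _] = [set w | rule_time N 0 w = n]); first exact: H.
  by apply/seteqP; split => w /=; [case|move=> ->].
elim: N k => [|N' IHN] k.
  have [<-|kn] := eqVneq k n.
    by rewrite (_ : [set _ | _] = setT)//; apply/seteqP; split.
  rewrite (_ : [set _ | _] = set0)//; apply/seteqP; split => // w /= /eqP.
  by rewrite (negbTE kn).
(* Time [n] cannot be hit once [k > n]; for [k <= n] the decision at time [k] belongs to the past of
   [n]. *)
have [nk|kn] := ltnP n k.
  rewrite (_ : [set _ | _] = set0)//; apply/seteqP; split => // w knw.
  have := rule_time_ge N'.+1 k w; rewrite knw.
  by rewrite leqNgt nk.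
pose E := [set w | D (u + walk X k w) (b + k)].
have mE : @measurable _ (g_sigma_algebraType G) E.
  apply: sub_gen_smallest; exists k => //.
  exists ((fun v => u + v) @^-1` [set v | D v (b + k)%N]).
    have : measurable_fun setT (fun v : R => u + v).
      by apply: measurable_funD.
    by move=> /(_ measurableT _ (mD (b + k))); rewrite setTI.
  by rewrite setTI.
rewrite (_ : [set _ | _] = (E `&` [set w | k = n]) `|`
    (~` E `&` [set w | rule_time N' k.+1 w = n])).
  apply: measurableU; apply: measurableI => //; last exact: measurableC.
  have [->|kn'] := eqVneq k n.
    by rewrite (_ : [set _ | _] = setT)//; apply/seteqP; split.
  rewrite (_ : [set _ | _] = set0)//; apply/seteqP; split => // w /= /eqP.
  by rewrite (negbTE kn').
apply/seteqP; split => [w|w] /=; rewrite /E /=.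
  by case: ifPn => [Dw ->|Dw ->]; [left|right].
by case=> [[-> ->//]|[/negP/negbTE -> //]].
Qed.

Lemma V_ge_game N : ((game D N u b)%:E <= V X u b)%E.
Proof.
apply: ereal_sup_ubound; exists (fun w => Some (rule_time N 0 w)).
  exact: rule_stopping_time.
have := @integral_rule_payoff N [::] isT.
rewrite big_nil addr0 addn0 expr0 mul1r => <-.
rewrite unlock; congr integral.
by apply/seteqP; split.
Qed.

End walk_value.

(** * Expectation of a product of independent variables *)

Section independent_product.
Context {R : realType} {d : measure_display} {Omega : measurableType d}.
Variable P : probability Omega R.

(** The joint law agrees with the product of the laws on rectangles, hence everywhere; Tonelli then
    separates the factors. *)
Lemma integral_independent_mul (f g : {mfun Omega >-> R}) :
  (forall w, 0 <= f w) -> (forall w, 0 <= g w) ->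
  (forall A B : set R, measurable A -> measurable B ->
    P (f @^-1` A `&` g @^-1` B) = P (f @^-1` A) * P (g @^-1` B))%E ->
  (\int[P]_w (f w * g w)%:E = \int[P]_w (f w)%:E * \int[P]_w (g w)%:E)%E.
Proof.
move=> f0 g0 ind.
pose phi w := (f w, g w).
have mphi : measurable_fun setT phi by exact: measurable_fun_pair.
pose phi' : {mfun Omega >-> (R * R)%type} := HB.pack phi (isMeasurableFun.Build _ _ _ _ phi mphi).
(* Absolute values make [h] nonnegative on the whole plane and change nothing on the range of
   [(f, g)]. *)
pose h (z : R * R) : \bar R := (`|z.1| * `|z.2|)%:E.
have mh : measurable_fun setT h.
  apply/measurable_EFinP; apply: measurable_funM.
    by apply: measurableT_comp => //; exact: measurable_fst.
  by apply: measurableT_comp => //; exact: measurable_snd.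
have h0 z : (0 <= h z)%E by rewrite lee_fin mulr_ge0.
transitivity (\int[pushforward P phi']_z h z)%E.
  rewrite ge0_integral_pushforward// preimage_setT.
  by apply: eq_integral => w _; rewrite /h /= !ger0_norm.
transitivity (\int[distribution P f \x distribution P g]_z h z)%E.
  apply: eq_measure_integral => A mA _; symmetry.
  exact: product_measure_unique.
rewrite fubini_tonelli1// /fubini_F.
have mabs : measurable_fun setT (fun x : R => `|x|%:E).
  by apply/measurable_EFinP; exact: normr_measurable.
under eq_integral => x _.
  rewrite /h /=.
  under eq_integral do rewrite EFinM.
  rewrite ge0_integralZl_EFin//; over.
rewrite ge0_integralZr//; last by apply: integral_ge0.
congr (_ * _)%E; rewrite /distribution ge0_integral_pushforward// preimage_setT.
  by apply: eq_integral => w _; rewrite /= ger0_norm.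
by apply: eq_integral => w _; rewrite /= ger0_norm.
Qed.

End independent_product.

(** * Exponential moments of the Gaussian law *)

Section gaussian_transform.
Context {R : realType}.
Local Notation mu := (@lebesgue_measure R).

(** The Radon-Nikodym derivative of the Gaussian law and [normal_pdf] have equal integrals over
    every measurable set, hence agree almost everywhere. *)
Lemma ge0_integral_normal_prob (m s : R) (f : R -> \bar R) :
  measurable_fun setT f -> (forall x, 0 <= f x)%E ->
  (\int[normal_prob m s]_x f x = \int[mu]_x (f x * (normal_pdf m s x)%:E))%E.
Proof.
move=> mf f0.
have dom := normal_prob_dominates m s.
rewrite -(Radon_Nikodym_SigmaFinite.change_of_variables dom f0 measurableT mf).
have iRN := Radon_Nikodym_SigmaFinite.f_integrable dom.
have mpdf : measurable_fun setT (fun x => (normal_pdf m s x)%:E).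
  by apply/measurable_EFinP; exact: measurable_normal_pdf.
apply: ae_eq_integral => //.
- by apply: emeasurable_funM => //; exact: measurable_int iRN.
- exact: emeasurable_funM.
- apply: ae_eqe_mul2l; apply: integral_ae_eq => // A _ mA.
  by rewrite -(Radon_Nikodym_SigmaFinite.f_integral dom mA).
Qed.

(** Exponential tilting: completing the square turns [exp (l x)] times the density of mean 0 into a
    constant times the density of mean [l s^2]. *)
Lemma normal_prob_exp (l s : R) : 0 < s ->
  (\int[normal_prob 0 s]_x (expR (l * x))%:E = (expR (l ^+ 2 * s ^+ 2 / 2))%:E)%E.
Proof.
move=> s0; rewrite ge0_integral_normal_prob; last 2 first.
- by apply/measurable_EFinP; apply: measurableT_comp => //; exact: mulrl_measurable.
- by move=> x; rewrite lee_fin expR_ge0.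
under eq_integral => x _.
  rewrite -EFinM (_ : expR (l * x) * _ = expR (l ^+ 2 * s ^+ 2 / 2) * normal_pdf (l * s ^+ 2) s x).
    rewrite EFinM; over.
  rewrite !normal_pdfE ?gt_eqF//= mulrCA [RHS]mulrCA; congr (_ * _).
  rewrite /normal_fun -!expRD; congr expR.
  by field; rewrite gt_eqF.
rewrite ge0_integralZl_EFin ?expR_ge0//.
- by rewrite integral_normal_pdf mule1.
- by move=> x _; rewrite lee_fin normal_pdf_ge0.
- by apply/measurable_EFinP; exact: measurable_normal_pdf.
Qed.

End gaussian_transform.

(** * Exponential martingales of Brownian motion at fixed times *)

Section brownian_supermartingale.
Context {R : realType} {d : measure_display} {Omega : measurableType d}.
Variables (P : probability Omega R) (W : R -> {RV P >-> R}).
Hypothesis hW : brownian_motion W.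
Implicit Types (s t l : R) (A : set Omega).

Let sig t := sigma_of `[0, t] W.

Definition exp_mart l t (w : Omega) : R := expR (l * W t w - l ^+ 2 * t / 2).

Lemma measurable_exp_mart l t : measurable_fun setT (exp_mart l t).
Proof.
apply: measurableT_comp => //; apply: measurable_funB => //.
exact: measurable_funM.
Qed.

Lemma sigma_of_measurable (D : set R) A : sigma_of D W A -> measurable A.
Proof.
apply: smallest_sub; first exact: sigma_algebra_measurable.
move=> B [i _ [C mC <-]]; rewrite setTI -[X in measurable X]setTI.
exact: measurable_funP.
Qed.

Lemma measurable_adapted s t : 0 <= s <= t ->
  measurable_fun setT (W s : g_sigma_algebraType
    (\bigcup_(i in `[0, t]%classic) preimage_set_system setT (W i) measurable) -> R).
Proof.
move=> st _ B mB; rewrite setTI; apply: sub_gen_smallest.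
by exists s; [rewrite /= in_itv|exists B => //; rewrite setTI].
Qed.

Lemma increment_exp l s t : 0 <= s -> s < t ->
  (\int[P]_w (expR (l * (W t w - W s w) - l ^+ 2 * (t - s) / 2))%:E = 1)%E.
Proof.
move=> s0 st; have [_ _ incr _] := hW.
have mD : measurable_fun setT (fun w => W t w - W s w) by exact: measurable_funB.
pose D : {mfun Omega >-> measurableTypeR R} := HB.pack (fun w => W t w - W s w)
  (isMeasurableFun.Build _ _ Omega (measurableTypeR R) _ mD).
have ts0 : 0 < t - s by rewrite subr_gt0.
have mexp : measurable_fun setT (fun x : R => (expR (l * x))%:E).
  by apply/measurable_EFinP; apply: measurableT_comp => //; exact: mulrl_measurable.
under eq_integral do rewrite expRD mulrC EFinM.
rewrite ge0_integralZl_EFin ?expR_ge0//; last exact: (measurableT_comp mexp mD).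
have -> : (\int[P]_w (expR (l * (W t w - W s w)))%:E =
    \int[normal_prob 0 (Num.sqrt (t - s))]_x (expR (l * x))%:E)%E.
  transitivity (\int[distribution P D]_x (expR (l * x))%:E)%E.
    by rewrite /distribution ge0_integral_pushforward ?preimage_setT.
  by apply: eq_measure_integral => B mB _; exact: incr.
rewrite normal_prob_exp ?sqrtr_gt0// sqr_sqrtr ?(ltW ts0)// -EFinM -expRD.
by rewrite addNr expR0.
Qed.

(** [exp_mart l t] is [exp_mart l s] times the exponential of an increment, which has mean 1 and is
    independent of the past; the indicator of [A] is part of the past factor [f]. *)
Lemma exp_mart_step l s t A : 0 <= s -> s < t -> sig s A ->
  (\int[P]_(w in A) (exp_mart l t w)%:E = \int[P]_(w in A) (exp_mart l s w)%:E)%E.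
Proof.
move=> s0 st sA; have [_ _ _ ind] := hW.
have mA := sigma_of_measurable sA.
pose f w := \1_A w * exp_mart l s w.
pose g w := expR (l * (W t w - W s w) - l ^+ 2 * (t - s) / 2).
have mf : measurable_fun setT f.
  by apply: measurable_funM; [exact: measurable_indic|exact: measurable_exp_mart].
pose h (x : R) := expR (l * x - l ^+ 2 * (t - s) / 2).
have mh : measurable_fun setT h.
  by apply: measurableT_comp => //; exact: measurable_funB.
have mg : measurable_fun setT g.
  by apply: (measurableT_comp mh); exact: measurable_funB.
pose f' : {mfun Omega >-> R} := HB.pack f (isMeasurableFun.Build _ _ _ _ f mf).
pose g' : {mfun Omega >-> R} := HB.pack g (isMeasurableFun.Build _ _ _ _ g mg).
rewrite integral_mkcond [RHS]integral_mkcond.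
transitivity (\int[P]_w (f' w * g' w)%:E)%E.
  apply: eq_integral => w _; rewrite patchE /= /f indicE.
  case: ifPn => wA; last by rewrite !mul0r.
  rewrite mul1r /g /exp_mart -expRD; congr (expR _)%:E.
  by field.
rewrite integral_independent_mul.
- rewrite increment_exp// mule1; apply: eq_integral => w _.
  rewrite patchE /= /f indicE; case: ifPn => wA; last by rewrite mul0r.
  by rewrite mul1r.
- by move=> w; rewrite mulr_ge0// expR_ge0.
- by move=> w; exact: expR_ge0.
move=> B1 B2 mB1 mB2.
have := ind s t s0 st (f @^-1` B1) (h @^-1` B2).
apply; last by rewrite -[X in measurable X]setTI; exact: mh.
pose G := \bigcup_(i in `[0, s]%classic) preimage_set_system setT (W i) measurable.
have mfG : measurable_fun setT (f : g_sigma_algebraType G -> R).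
  apply: measurable_funM.
    exact: (@measurable_indic _ (g_sigma_algebraType G)).
  apply: measurableT_comp => //; apply: measurable_funB => //.
  apply: measurable_funM => //; apply: measurable_adapted.
  by rewrite s0 lexx.
by have := mfG measurableT B1 mB1; rewrite setTI.
Qed.

End brownian_supermartingale.

(** * Exponential martingales at a stopping time *)

Section stopped_exponential.
Context {R : realType} {d : measure_display} {Omega : measurableType d}.
Variables (P : probability Omega R) (W : R -> {RV P >-> R}).
Hypothesis hW : brownian_motion W.
Variable T : Omega -> \bar R.
Hypothesis hT : brownian_stopping_time W T.
Variable l : R.

Local Notation M := (exp_mart W l).

Definition before (h : R) (k : nat) : set Omega := [set w | (T w <= (k%:R * h)%:E)%E].

(** The event that [k * h] is the first grid point at or after [T]. *)
Definition first_grid (h : R) (k : nat) : set Omega :=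
  before h k `\` (if k is k'.+1 then before h k' else set0).

Lemma before_adapted (h : R) k : 0 <= h -> sigma_of `[0, k%:R * h] W (before h k).
Proof. by move=> h0; have [_ aT _] := hT; apply: aT; rewrite mulr_ge0. Qed.

Lemma measurable_before (h : R) k : 0 <= h -> measurable (before h k).
Proof.
move=> h0; exact: (@sigma_of_measurable _ _ _ P W _ _ (@before_adapted h k h0)).
Qed.

Lemma measurable_first_grid (h : R) k : 0 <= h -> measurable (first_grid h k).
Proof.
move=> h0; apply: measurableD; first exact: measurable_before.
by case: k => // k; exact: measurable_before.
Qed.

Let M_ge0 t w : (0 <= (M t w)%:E)%E. Proof. by rewrite lee_fin expR_ge0. Qed.

Let mM t A : measurable_fun A (EFin \o M t).
Proof. by apply/measurable_EFinP; apply: measurable_funTS; exact: measurable_exp_mart. Qed.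

Lemma grid_sum (h : R) K : 0 < h ->
  (\sum_(k < K.+1) \int[P]_(w in first_grid h k) (M (k%:R * h) w)%:E +
   \int[P]_(w in ~` before h K) (M (K%:R * h) w)%:E = 1)%E.
Proof.
move=> h0; have h0' := ltW h0.
have mB k := measurable_before k h0'.
elim: K => [|K IHK].
  rewrite big_ord_recr big_ord0/= add0e /first_grid setD0 mul0r.
  rewrite -integral_setU//; last 3 first.
  - exact: measurableC.
  - exact: mM.
  - by apply/disj_setPS => w [].
  rewrite setUv; have [W0 _ _ _] := hW.
  rewrite (ae_eq_integral (cst 1%E))//.
  - by rewrite integral_cst// mul1e; exact: probability_setT.
  - exact: mM.
  apply: filterS W0 => w W0w _.
  by rewrite /exp_mart W0w !mulr0 mul0r subr0 expR0.
rewrite -[RHS]IHK big_ord_recr/= -addeA; congr adde.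
have DU : (~` before h K = first_grid h K.+1 `|` ~` before h K.+1)%classic.
  apply/seteqP; split => [w nK|w [[_ //]|nSK]].
    by have [K1|K1] := pselect (before h K.+1 w); [left|right].
  move=> Kw; apply: nSK; apply: (le_trans Kw).
  by rewrite lee_fin ler_wpM2r// ler_nat.
have mC : measurable (~` before h K.+1) by exact: measurableC.
rewrite DU -integral_setU//.
- rewrite -DU; apply: exp_mart_step => //.
  + by rewrite mulr_ge0.
  + by rewrite ltr_pM2r// ltr_nat.
  + by apply: sigma_algebraC; exact: before_adapted.
- exact: measurable_first_grid.
- exact: mM.
- by apply/disj_setPS => w [[]].
Qed.

Lemma grid_sum_le1 (h : R) K : 0 < h ->
  (\sum_(k < K.+1) \int[P]_(w in first_grid h k) (M (k%:R * h) w)%:E <= 1)%E.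
Proof.
by move=> h0; rewrite -(grid_sum K h0) leeDl// integral_ge0.
Qed.

(** Mesh [1 / (n + 1)] and [(n + 1)^2] steps reach time [n + 1], so mesh and horizon improve
    together. At most one summand is nonzero: the martingale at the first grid point at or after
    [T]. *)
Definition grid_approx (n : nat) (w : Omega) : \bar R :=
  (\sum_(k < (n.+1 * n.+1).+1)
    ((fun w => (M (k%:R * n.+1%:R^-1) w)%:E) \_ (first_grid n.+1%:R^-1 k)) w)%E.

Let h_gt0 (n : nat) : 0 < (n.+1%:R^-1 : R). Proof. by rewrite invr_gt0. Qed.

Let term_ge0 (n k : nat) w :
  (0 <= ((fun w => (M (k%:R * n.+1%:R^-1) w)%:E) \_ (first_grid n.+1%:R^-1 k)) w)%E.
Proof. by rewrite patchE; case: ifP. Qed.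

Let measurable_term (n k : nat) : measurable_fun setT
  ((fun w => (M (k%:R * n.+1%:R^-1) w)%:E) \_ (first_grid n.+1%:R^-1 k)).
Proof.
apply/(measurable_restrictT _ _).1; last exact: mM.
by apply: measurable_first_grid; exact: ltW.
Qed.

Lemma measurable_grid_approx n : measurable_fun setT (grid_approx n).
Proof. by apply: emeasurable_sum => k; exact: measurable_term. Qed.

Lemma grid_approx_ge0 n w : (0 <= grid_approx n w)%E.
Proof. by apply: sume_ge0 => k _; exact: term_ge0. Qed.

Lemma integral_grid_approx n : (\int[P]_w grid_approx n w <= 1)%E.
Proof.
rewrite /grid_approx ge0_integral_sum//.
apply: (le_trans _ (grid_sum_le1 (n.+1 * n.+1) (h_gt0 n))).
by apply: lee_sum => k _; rewrite -integral_mkcond.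
Qed.

Lemma grid_approxE n w (t : R) : T w = t%:E -> 0 <= t -> t <= n.+1%:R ->
  exists2 s : R, t <= s < t + n.+1%:R^-1 & grid_approx n w = (M s w)%:E.
Proof.
move=> Tw t0 tn; set h := n.+1%:R^-1; have h0 : 0 < h by exact: h_gt0.
have ex : exists k : nat, t <= k%:R * h.
  by exists (n.+1 * n.+1)%N; rewrite natrM mulfK.
have [k tk kmin] : exists2 k : nat, t <= k%:R * h &
    forall j : nat, t <= j%:R * h -> (k <= j)%N.
  by case: (ex_minnP ex) => k ? ?; exists k.
have kn : (k < (n.+1 * n.+1).+1)%N.
  by rewrite ltnS; apply: kmin; rewrite natrM mulfK.
have first j : first_grid h j w <-> j = k.
  rewrite /first_grid /before /= Tw; split => [[]|->].
    rewrite lee_fin => tj nj; apply/eqP; rewrite eqn_leq kmin// andbT.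
    rewrite leqNgt; apply/negP => kj; apply: nj.
    case: j tj kj => // j _ kj.
    change (is_true (T w <= (j%:R * h)%:E)%E); rewrite Tw lee_fin (le_trans tk)//.
    by rewrite ler_wpM2r ?(ltW h0)// ler_nat.
  rewrite lee_fin; split => //.
  case: k kmin {tk kn} => [_ []//|k kmin Bw].
  have : (T w <= (k%:R * h)%:E)%E := Bw.
  rewrite Tw lee_fin => tk.
  by have := kmin _ tk; rewrite ltnn.
exists (k%:R * h).
  rewrite tk/=.
  case: (posnP k) => [->|k0]; first by rewrite mul0r ltr_wpDl.
  have : k.-1%:R * h < t.
    rewrite ltNge; apply/negP => /kmin; rewrite -ltnS prednK//.
    by rewrite ltnn.
  rewrite -[in X in _ -> X](prednK k0) -natr1 mulrDl mul1r; lra.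
rewrite /grid_approx (bigD1 (Ordinal kn))//= big1 ?adde0.
  by rewrite patchE ifT// inE; apply/first.
move=> j jk; rewrite patchE ifF//; apply/negP; rewrite inE => /first jE.
by move: jk; rewrite -val_eqE /= jE eqxx.
Qed.

Hypothesis mWT : measurable_fun setT (fun w => W (fine (T w)) w).
Hypothesis mT : measurable_fun setT (fun w => fine (T w)).

Lemma grid_approx_cvg w : (0 <= T w)%E -> (T w < +oo)%E ->
  {within `[0%R, +oo[, continuous (fun t => W t w)} ->
  grid_approx n w @[n --> \oo] --> (M (fine (T w)) w)%:E.
Proof.
move=> T0 Ty cW; pose t := fine (T w).
have tE : T w = t%:E by rewrite /t fineK// ge0_fin_numE.
have t0 : 0 <= t by rewrite -lee_fin -tE.
have cM : M s w @[s --> within `[0%R, +oo[ (nbhs t)] --> M t w.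
  apply: (cvg_comp _ expR); last exact: continuous_expR.
  apply: cvgB; last first.
    apply: cvg_within_filter; apply: cvgM; last exact: cvg_cst.
    by apply: cvgM; [exact: cvg_cst|exact: cvg_id].
  apply: cvgM; first exact: cvg_cst.
  by move/subspace_continuousP : cW => /(_ t); apply; rewrite /= in_itv/= t0.
have big : \forall n \near \oo, t <= n.+1%:R.
  near=> n; apply: (@le_trans _ _ n%:R); last by rewrite ler_nat.
  by near: n; exact: nbhs_infty_ger.
apply: cvg_EFin.
  by apply: filterS big => n /(grid_approxE tE t0)[s _ ->].
apply/cvgrPdist_lt => e e0.
have /cvgrPdist_lt/(_ _ e0) := cM.
rewrite near_withinE => -[dl /= dl0 H].
near=> n.
have [|s /andP[ts st] ->] := @grid_approxE n w t tE t0.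
  by near: n.
apply: H; last by rewrite in_itv/= (le_trans t0).
rewrite /= ler0_norm; last by rewrite subr_le0.
rewrite opprB ltrBlDl (lt_trans st)// ltrD2l.
near: n.
have := @near_infty_natSinv_lt R (PosNum dl0).
by apply: filterS => n /=; rewrite ltNge.
Unshelve. all: by end_near. Qed.

(* Only [<= 1] is claimed: Fatou along the discretizations of [T] from above. *)
Lemma exp_mart_stopped : (\int[P]_w (M (fine (T w)) w)%:E <= 1)%E.
Proof.
have mS : measurable_fun setT (fun w => (M (fine (T w)) w)%:E).
  apply/measurable_EFinP; apply: measurableT_comp => //.
  apply: measurable_funB; first exact: measurable_funM.
  by apply: measurable_funM => //; exact: measurable_funM.
have [T0 _ Ty] := hT; have [_ cW _ _] := hW.
apply: (@le_trans _ _ (\int[P]_w limn_einf (grid_approx ^~ w))%E).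
  apply: ae_ge0_le_integral => //.
  - move=> w _; rewrite limn_einf_lim; apply: lime_ge; first exact: is_cvg_einfs.
    apply: nearW => n; apply: le_ereal_inf_tmp => _ [m _ <-].
    exact: grid_approx_ge0.
  - under eq_fun do rewrite limn_einf_lim.
    apply: (emeasurable_fun_cvg (fun n w => einfs (grid_approx ^~ w) n)).
      exact: measurable_fun_einfs measurable_grid_approx.
    by move=> w _; exact: is_cvg_einfs.
  apply: filterS2 Ty cW => w Tw cWw _.
  have /cvg_lim := grid_approx_cvg (T0 w) Tw cWw.
  rewrite is_cvg_limn_einfE; last first.
    by apply/cvg_ex; exists (M (fine (T w)) w)%:E; exact: grid_approx_cvg.
  by move=> ->.
have := fatou P measurableT measurable_grid_approx (fun n w _ => grid_approx_ge0 n w).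
move=> /le_trans; apply.
rewrite limn_einf_lim; apply: lime_le; first exact: is_cvg_einfs.
apply: nearW => n; apply: le_trans (integral_grid_approx n).
by apply: ereal_inf_lbound; exists n => /=.
Qed.

End stopped_exponential.

(** * The upper bound for the Brownian value *)

Section brownian_value.
Context {R : realType} {d : measure_display} {Omega : measurableType d}.
Variables (P : probability Omega R) (W : R -> {RV P >-> R}).
Hypothesis hW : brownian_motion W.
Variable a : R.
Hypothesis a34 : 3 / 4 <= a < 1.
Hypothesis aE : a = (1 - a ^+ 2) * mom 0 a 1.
Local Notation mu := (@lebesgue_measure R).
Local Notation half := (`[0, +oo[%classic : set R).

Lemma shepp_majorant (x t : R) : 0 < t -> x / t <= (1 - a ^+ 2) * mom 0 x t.
Proof.
move=> t0; pose r := (Num.sqrt t)^-1.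
have r0 : 0 < r by rewrite invr_gt0 sqrtr_gt0.
have rt : r ^+ 2 * t = 1.
  by rewrite /r exprVn sqr_sqrtr ?(ltW t0)// mulVf// gt_eqF.
rewrite (mom_scale _ _ r0 rt) expr1 mulrCA.
have -> : x / t = r * (x * r).
  by rewrite -[x in LHS]mulr1 -rt; field; rewrite gt_eqF.
by rewrite ler_pM2l// shepp_tangent.
Qed.

Section stopped.
Variable T : Omega -> \bar R.
Hypothesis hT : brownian_stopping_time W T.

Lemma measurable_fine_stopping : measurable_fun setT (fun w => fine (T w)).
Proof.
have [T0 _ _] := hT.
have mle (t : R) : 0 <= t -> measurable [set w | (T w <= t%:E)%E].
  move=> t0; have [_ aT _] := hT.
  exact: (@sigma_of_measurable _ _ _ P W _ _ (aT t t0)).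
apply: (measurability _ (RGenOInfty.measurableE R)) => //.
move=> _ [_ [x ->] <-]; rewrite setTI.
have [x0|x0] := ltP x 0.
  rewrite (_ : _ @^-1` _ = setT)//; apply/seteqP; split => // w _ /=.
  by rewrite in_itv/= andbT (lt_le_trans x0)// fine_ge0.
(* [fine] sends +oo to 0, so infinite values of [T] do not belong to the preimage; the union over
   [n] excludes them. *)
rewrite (_ : _ @^-1` _ = ~` [set w | (T w <= x%:E)%E] `&`
    \bigcup_n [set w | (T w <= n%:R%:E)%E]).
  apply: measurableI; first exact/measurableC/mle.
  by apply: bigcup_measurable => n _; exact: mle.
apply/seteqP; split => w /=; rewrite in_itv/= andbT.
  move=> xT; have Tfin : T w \is a fin_num.
    by have := T0 w; move: xT; case: (T w) => //=; rewrite ltNge x0.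
  split; first by rewrite -(fineK Tfin) lee_fin; apply/negP; rewrite -ltNge.
  exists (Num.bound (fine (T w))) => //=; rewrite -(fineK Tfin) lee_fin.
  by rewrite ltW// archi_boundP// fine_ge0.
move=> [nx [n _ /= Tn]]; have Tfin : T w \is a fin_num.
  by rewrite ge0_fin_numE// (le_lt_trans Tn)// ltry.
by rewrite ltNge; apply/negP => Tx; apply: nx; rewrite -(fineK Tfin) lee_fin.
Qed.

Variables (u c b : R).
Hypothesis b0 : 0 < b.
Hypothesis c0 : 0 <= c.
Hypothesis iT : P.-integrable setT (EFin \o brownian_payoff W (u + c) b T).

Let bT_gt0 w : 0 < b + fine (T w).
Proof. by have [T0 _ _] := hT; rewrite ltr_wpDr// fine_ge0. Qed.

(** Measurability of the stopped path is recovered from that of the integrable payoff: multiply by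
    [b + T] and subtract the constant. *)
Lemma measurable_stopped_brownian : measurable_fun setT (fun w => W (fine (T w)) w).
Proof.
have := measurable_int _ iT => /measurable_EFinP mp.
rewrite (_ : (fun w => _) = fun w => brownian_payoff W (u + c) b T w * (b + fine (T w)) - (u + c)).
  apply: measurable_funB => //; apply: measurable_funM => //.
  by apply: measurable_funD => //; exact: measurable_fine_stopping.
apply/funext => w; rewrite /brownian_payoff divfK ?gt_eqF//; first ring.
Qed.

(** The exponents add up to [y (u + W_T) - y^2 (b + T) / 2]. Integrating in [y] first gives [mom 0]
    at the stopped point; integrating over the sample space first bounds each exponential martingale
    by 1. The half-line enters as an indicator so that Tonelli applies on the full product. *)
Let H (z : Omega * measurableTypeR R) : \bar R :=
  (\1_half z.2 * expR (u * z.2 - b * z.2 ^+ 2 / 2) *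
    exp_mart W z.2 (fine (T z.1)) z.1)%:E.

Let H_ge0 z : (0 <= H z)%E.
Proof. by rewrite lee_fin !mulr_ge0 ?expR_ge0. Qed.

Let measurable_H : measurable_fun setT H.
Proof.
have m2 : measurable_fun setT (fun z : Omega * measurableTypeR R => z.2).
  exact: measurable_snd.
have mWT : measurable_fun setT (fun z : Omega * measurableTypeR R => W (fine (T z.1)) z.1).
  exact: (measurableT_comp measurable_stopped_brownian measurable_fst).
have mT : measurable_fun setT (fun z : Omega * measurableTypeR R => fine (T z.1)).
  exact: (measurableT_comp measurable_fine_stopping measurable_fst).
apply/measurable_EFinP; apply: measurable_funM; first apply: measurable_funM.
- have mI : measurable_fun setT (\1_half : measurableTypeR R -> R) by exact: measurable_indic.
  exact: (measurableT_comp mI m2).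
- apply: measurableT_comp => //; apply: measurable_funB.
    exact: measurable_funM.
  by do 2 apply: measurable_funM => //; exact: measurable_funX.
- apply: measurableT_comp => //; apply: measurable_funB.
    exact: measurable_funM.
  by apply: measurable_funM => //; apply: measurable_funM => //; exact: measurable_funX.
Qed.

Let H_mom w : (\int[mu]_y H (w, y) =
  (mom 0 (u + W (fine (T w)) w) (b + fine (T w)))%:E)%E.
Proof.
rewrite -integral_gauss_mono// [RHS]integral_mkcond.
apply: eq_integral => y _; rewrite /H /= patchE indicE.
case: ifPn => _; last by rewrite !mul0r.
rewrite /gauss_mono expr0 !mul1r /exp_mart -expRD; congr (expR _)%:E.
by field.
Qed.

Let integral_H : (\int[P]_w \int[mu]_y H (w, y) <= (mom 0 u b)%:E)%E.
Proof.
rewrite fubini_tonelli// -integral_gauss_mono// [leRHS]integral_mkcond.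
apply: ge0_le_integral => //.
- by move=> y _; apply: integral_ge0 => w _; exact: H_ge0.
- exact: (measurable_fun_fubini_tonelli_G H).
- apply/(measurable_restrictT _ _).1 => //; apply/measurable_EFinP.
  by apply: measurable_funTS; exact: measurable_gauss_mono.
move=> y _; rewrite patchE /H /=.
under eq_integral do rewrite EFinM.
have k0 : 0 <= \1_half y * expR (u * y - b * y ^+ 2 / 2).
  by rewrite mulr_ge0// expR_ge0.
have mexp : measurable_fun setT (fun w => (exp_mart W y (fine (T w)) w)%:E).
  apply/measurable_EFinP; apply: measurableT_comp => //; apply: measurable_funB.
    by apply: measurable_funM => //; exact: measurable_stopped_brownian.
  apply: measurable_funM => //; apply: measurable_funM => //.
  exact: measurable_fine_stopping.
have e0 w : setT w -> (0 <= (exp_mart W y (fine (T w)) w)%:E)%E.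
  by rewrite lee_fin expR_ge0.
rewrite (ge0_integralZl_EFin P measurableT e0 mexp k0).
rewrite indicE; case: ifPn => _; last by rewrite mul0r mul0e.
rewrite mul1r /gauss_mono expr0 mul1r -[leRHS]mule1 lee_pmul2l ?lte_fin ?expR_gt0//.
by apply: exp_mart_stopped => //; [exact: measurable_stopped_brownian|exact: measurable_fine_stopping].
Qed.

(** [c / (b + T) <= c / b] splits off the excess; the rest is dominated by [shepp_majorant] at
    [(u + W_T, b + T)], whose mean [integral_H] controls. *)
Lemma brownian_payoff_le :
  ('E_P[brownian_payoff W (u + c) b T] <= ((1 - a ^+ 2) * mom 0 u b + c / b)%:E)%E.
Proof.
have C0 : 0 < 1 - a ^+ 2 by case/andP: a34 => *; nra.
rewrite unlock.
pose F w := ((1 - a ^+ 2)%:E * \int[mu]_y H (w, y) + (c / b)%:E)%E.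
have mF : measurable_fun setT F.
  apply: emeasurable_funD => //; apply: measurable_funeM.
  exact: (measurable_fun_fubini_tonelli_F H).
have iH0 w : (0 <= \int[mu]_y H (w, y))%E by apply: integral_ge0.
have pF w : ((brownian_payoff W (u + c) b T w)%:E <= F w)%E.
  rewrite /F H_mom -EFinM -EFinD lee_fin /brownian_payoff.
  rewrite addrAC mulrDl lerD ?shepp_majorant// ler_wpM2l//.
  by rewrite lef_pV2 ?posrE// lerDl; have [T0 _ _] := hT; exact: fine_ge0.
have F0 w : (0 <= F w)%E.
  by rewrite /F adde_ge0 ?mule_ge0 ?lee_fin ?(ltW C0)// divr_ge0// ltW.
have cb0 : 0 <= c / b by rewrite divr_ge0// ltW.
have Ic : (\int[P]_w (c / b)%:E = (c / b)%:E)%E.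
  rewrite integral_cst//; apply: (etrans (congr1 (mule _) (probability_setT P))).
  exact: mule1.
have mH := measurable_fun_fubini_tonelli_F H.
have IF : (\int[P]_w F w <= ((1 - a ^+ 2) * mom 0 u b + c / b)%:E)%E.
  rewrite /F ge0_integralD//.
  - rewrite Ic ge0_integralZl_EFin ?(ltW C0)//; last exact: mH.
    rewrite (_ : (_ + c / b)%:E =
      (1 - a ^+ 2)%:E * (mom 0 u b)%:E + (c / b)%:E)%E; last first.
      by rewrite -EFinM -EFinD.
    apply: leeD => //.
    by apply: lee_wpmul2l; rewrite ?lee_fin ?(ltW C0).
  - by move=> w _; rewrite mule_ge0// lee_fin ltW.
  - by apply: measurable_funeM; exact: mH.
apply: (le_trans _ IF); apply: le_integral => //.
apply/integrableP; split => //.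
under eq_integral do rewrite gee0_abs//.
exact: le_lt_trans IF (ltry _).
Qed.

End stopped.

End brownian_value.

(** * Comparison of the two values *)

Local Open Scope ereal_scope.

Theorem lemma1p2 (R : realType)
    (d : measure_display) (Omega : measurableType d)
    (P : probability Omega R) (X : nat -> {RV P >-> R})
    (hX : fair_coin_steps X)
    (d' : measure_display) (Omega' : measurableType d')
    (P' : probability Omega' R) (W : R -> {RV P' >-> R})
    (hW : brownian_motion W)
    (u : R) (b : nat) (hb : (1600 < b)%N) :
  V_W W u b%:R *
    (1 - 5 / (12 * b%:R) * (1 + (Num.sqrt (b%:R : R))^-1))%:E
  <= V X u b.
Proof.
have [a a34 aE] := @shepp_constant R.
have b0 : (0 < b)%N by rewrite (leq_ltn_trans _ hb).
have b0' : (0 < b%:R :> R)%R by rewrite ltr0n.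
pose rho : R := (1 - 5 / (12 * b%:R) * (1 + (Num.sqrt (b%:R : R))^-1))%R.
have mD k : measurable [set v : R | stop_rule a v k].
  rewrite (_ : [set v | _] = `[(a * Num.sqrt (k%:R : R) - 1 / 2)%R, +oo[%classic).
    exact: measurable_itv.
  by apply/seteqP; split => v /=; rewrite in_itv/= andbT.
have VN N : (game (stop_rule a) N u b)%:E <= V X u b.
  exact: V_ge_game.
have s1 : (1 <= Num.sqrt (b%:R : R))%R.
  by rewrite -[leLHS]sqrtr1 ler_sqrt// ler1n.
have q0 : (0 <= 5 / (12 * b%:R) :> R)%R.
  by rewrite divr_ge0// mulr_ge0// ltW.
have rho1 : (rho <= 1)%R.
  by rewrite /rho gerBl mulr_ge0// addr_ge0// invr_ge0 sqrtr_ge0.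
have rho0 : (0 <= rho)%R.
  have h1 : ((Num.sqrt (b%:R : R))^-1 <= 1)%R by rewrite invf_le1// (lt_le_trans _ s1).
  have h2 : (5 / (12 * b%:R) <= 1 / 2 :> R)%R.
    rewrite ler_pdivrMr ?mulr_gt0//.
    have : (1 <= b%:R :> R)%R by rewrite ler1n.
    by move: (b%:R : R)%R => y; lra.
  have : (5 / (12 * b%:R) * (1 + (Num.sqrt (b%:R : R))^-1) <= 1 / 2 * 2)%R.
    by apply: ler_pM => //; lra.
  by rewrite /rho; lra.
(* Every splitting [u = u0 + c] with [c >= 0] gives a bound: [c = 0] serves up to the curve, and
   [u0] on the curve serves above it. *)
have VW (u0 c : R) (c0 : (0 <= c)%R) : u = (u0 + c)%R ->
    V_W W u b%:R <= ((1 - a ^+ 2) * mom 0 u0 b%:R + c / b%:R)%:E.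
  move=> ->; apply: ge_ereal_sup => _ [T [hT iT] <-].
  exact: brownian_payoff_le.
have [ua|ua] := leP u (a * Num.sqrt (b%:R : R))%R.
  have := VW u 0%R (lexx _); rewrite addr0 mul0r addr0 => /(_ erefl) VWu.
  apply: (@le_trans _ _ ((1 - a ^+ 2) * mom 0 u b%:R * rho)%:E).
    by rewrite EFinM lee_wpmul2r.
  apply/lee_addgt0Pr => e e0.
  have [N gN] := game_start a34 aE hb ua e0.
  rewrite -leeBlDr//; apply: le_trans (VN N).
  by rewrite -EFinB lee_fin.
pose u0 : R := (a * Num.sqrt (b%:R : R))%R.
have uu0 : (0 <= u - u0)%R by rewrite subr_ge0 ltW.
have u_gt0 : (0 <= u)%R.
  apply: le_trans (ltW ua); rewrite mulr_ge0 ?sqrtr_ge0//.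
  by case/andP: a34 => h _; lra.
have VWu : V_W W u b%:R <= (u / b%:R)%:E.
  apply: (le_trans (VW u0 (u - u0)%R uu0 _)); first by rewrite subrKC.
  rewrite lee_fin.
  (* On the curve the defining equation of [a] makes the majorant equal to the payoff. *)
  suff -> : ((1 - a ^+ 2) * mom 0 u0 b%:R = u0 / b%:R)%R.
    by rewrite -mulrDl subrKC.
  have s0 : (0 < (Num.sqrt (b%:R : R))^-1)%R by rewrite invr_gt0 sqrtr_gt0.
  have sb : ((Num.sqrt (b%:R : R))^-1 ^+ 2 * b%:R = 1)%R.
    by rewrite exprVn sqr_sqrtr ?ltW// mulVf ?gt_eqF.
  rewrite (mom_scale 0 u0 s0 sb) /u0 mulfK ?gt_eqF ?sqrtr_gt0// expr1 mulrCA.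
  rewrite -aE mulrC -mulrA; congr (_ * _)%R.
  by rewrite -[X in (_ / X)%R](sqr_sqrtr (ltW b0')) expr2 invfM mulrA mulfV ?mul1r ?gt_eqF ?sqrtr_gt0.
(* Above the curve the walk stops at once: horizon 0 yields [u / b], and [rho <= 1] concludes. *)
apply: (le_trans _ (VN 0%N)) => /=.
apply: (@le_trans _ _ ((u / b%:R)%:E * rho%:E)); first by rewrite lee_wpmul2r.
by rewrite -EFinM lee_fin ler_piMr// divr_ge0// ltW.
Qed.
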